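(* Let $m>0$ and $k\in\mathbb R$. Then, as distributions in the variable $\xi$ in the upper half plane, $$\lim_{r\to\infty} w_r(\xi,m\xi-k)\,\mathbf 1_{(k/m,\infty)}(\xi)=v(\xi,m\xi-k)\,\mathbf 1_{(k/m,\infty)}(\xi)\qquad\text{in }\mathcal S'(\mathbb R).$$ If $m<0$, the analogous result holds with the characteristic function $\mathbf 1_{(-\infty,k/m)}$ instead, that is, $$\lim_{r\to\infty} w_r(\xi,m\xi-k)\,\mathbf 1_{(-\infty,k/m)}(\xi)=v(\xi,m\xi-k)\,\mathbf 1_{(-\infty,k/m)}(\xi)\qquad\text{in }\mathcal S'(\mathbb R).$$ If the distributions are considered in the whole plane with $\xi\in\mathbb R$ (with $w_r(\xi,\zeta)=w_r(\xi,|\zeta|)$ for all $\zeta\in\mathbb R$), then $\lim_{r\to\infty} w_r(\xi,m\xi-k)=v(\xi,|m\xi-k|)$ in $\mathcal S'(\mathbb R)$.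
   Context: For real $r>0$, $\xi\in\mathbb R$ and $\zeta\ge 0$, set $$w_r(\xi,\zeta)=e^{-2\pi i r^2\zeta}\sum_{n\in\mathbb Z} e^{2\pi i r^2\sqrt{1-(n/r)^2}\,\zeta}\,e^{2\pi i n\xi},$$ with the convention $\sqrt{1-(n/r)^2}=i\sqrt{(n/r)^2-1}$ when $|n|>r$ (so those terms carry the decaying factor $e^{-2\pi r^2\sqrt{(n/r)^2-1}\,\zeta}$). For $\zeta<0$ set $w_r(\xi,\zeta)=w_r(\xi,|\zeta|)$. Let $$v(\xi,\zeta)=\sum_{n\in\mathbb Z}e^{2\pi i n\xi-i\pi n^2\zeta}.$$ On an oblique line $\zeta=m\xi-k$, $v$ is understood as a tempered distribution in the variable $\xi$: $\langle v(\xi,m\xi-k),\varphi(\xi)\rangle=\sum_{n\in\mathbb Z}e^{i\pi n^2k}\,\widehat\varphi\left(\frac{mn^2}{2}-n\right)$ for $\varphi\in\mathcal S(\mathbb R)$, where $\widehat\varphi(x)=\int_{\mathbb R}\varphi(\xi)e^{-2\pi i x\xi}\,d\xi$. Correspondingly, for an interval $J$, $$\langle v(\xi,m\xi-k)\mathbf 1_{J},\varphi\rangle=\sum_{n\in\mathbb Z}\int_J\varphi(\xi)e^{2\pi i n\xi-i\pi n^2(m\xi-k)}\,d\xi,\qquad \langle v(\xi,|m\xi-k|),\varphi\rangle=\sum_{n\in\mathbb Z}\int_{\mathbb R}\varphi(\xi)e^{2\pi i n\xi-i\pi n^2|m\xi-k|}\,d\xi .$$ Functions act on $\varphi\in\mathcal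 S(\mathbb R)$ by integration against $\varphi$. $\mathbf 1_A$ denotes the characteristic function of $A$. The upper half plane is $\{(\xi,\zeta):\zeta>0\}$. Convergence $T_r\to T$ in $\mathcal S'(\mathbb R)$ means $\langle T_r,\varphi\rangle\to\langle T,\varphi\rangle$ for every $\varphi\in\mathcal S(\mathbb R)$.
   Formalization: When k/m is an integer, only test functions φ with φ(k/m)=0 are considered, since w_r(ξ,mξ−k) then behaves like C_r/|ξ−k/m| with C_r>0 near k/m and its integral against φ diverges for every r>0 if φ(k/m)≠0. *)

(* Defs.v *)
From HB Require Import structures.
From mathcomp Require Import all_boot all_order all_algebra.
From mathcomp Require Import complex.
From mathcomp Require Import all_classical all_reals all_analysis.

Set Implicit Arguments.
Unset Strict Implicit.
Unset Printing Implicit Defensive.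

Import Order.TTheory GRing.Theory Num.Theory.
Import numFieldNormedType.Exports.

Local Open Scope classical_set_scope.
Local Open Scope complex_scope.
Local Open Scope ring_scope.

(* Limits, sums, derivatives and integrals of complex-valued functions are
   taken on the real and imaginary parts. *)

Section Complex.
Variable R : realType.

Local Notation Re := (@complex.Re R).
Local Notation Im := (@complex.Im R).
Local Notation mu := (@lebesgue_measure R).

Definition cexp (z : R[i]) : R[i] :=
  (expR (Re z) * cos (Im z)) +i* (expR (Re z) * sin (Im z)).

(* The root of a negative number lies on the positive imaginary axis. *)
Definition csqrt (x : R) : R[i] :=
  if 0 <= x then (Num.sqrt x)%:C else 'i%C * (Num.sqrt (- x))%:C.

Definition ccvg_pinfty (f : R -> R[i]) (l : R[i]) : Prop :=
  (Re (f r) @[r --> +oo] --> Re l) /\ (Im (f r) @[r --> +oo] --> Im l).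

(* Real series over the integers: the limit of the symmetric partial sums,
   which is the unordered sum whenever the family is summable. *)
Definition zsumR (u : int -> R) : R :=
  limn (fun N => u 0 + \sum_(1 <= n < N.+1) (u n%:Z + u (- n%:Z))).

Definition zsum (u : int -> R[i]) : R[i] :=
  zsumR (fun n => Re (u n)) +i* zsumR (fun n => Im (u n)).

Definition zsummable (u : int -> R[i]) : Prop :=
  summable [set: int] (fun n => (Re (u n))%:E) /\
  summable [set: int] (fun n => (Im (u n))%:E).

Definition cintegrable (J : set R) (f : R -> R[i]) : Prop :=
  mu.-integrable J (fun x => (Re (f x))%:E) /\
  mu.-integrable J (fun x => (Im (f x))%:E).

Definition cintegral (J : set R) (f : R -> R[i]) : R[i] :=
  (\int[mu]_(x in J) Re (f x)) +i* (\int[mu]_(x in J) Im (f x)).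

Definition rschwartz (f : R -> R) : Prop :=
  (forall (n : nat) (x : R), derivable (derive1n n f) x 1) /\
  (forall j n : nat, exists M : R, forall x : R, `|x ^+ j * derive1n n f x| <= M).

Definition schwartz (phi : R -> R[i]) : Prop :=
  rschwartz (fun x => Re (phi x)) /\ rschwartz (fun x => Im (phi x)).

(* The absolute value extends the function evenly to zeta < 0.  For r > 0, zeta <> 0
   the series converges absolutely; it diverges at zeta = 0, which a line of
   nonzero slope meets in a single, Lebesgue-negligible, point. *)
Definition w (r xi zeta : R) : R[i] :=
  cexp (- 'i%C * (2 * pi * r ^+ 2 * `|zeta|)%:C) *
  zsum (fun n =>
    cexp ('i%C * (2 * pi * r ^+ 2)%:C * csqrt (1 - (n%:~R / r) ^+ 2)
             * (`|zeta|)%:C) *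
    cexp ('i%C * (2 * pi * n%:~R * xi)%:C)).

(* Pairing of the function f, cut off to J, with phi. *)
Definition fun_pairing (J : set R) (f phi : R -> R[i]) : R[i] :=
  cintegral J (fun xi => f xi * phi xi).

Definition fun_pairing_defined (J : set R) (f phi : R -> R[i]) : Prop :=
  cintegrable J (fun xi => f xi * phi xi).

(* Pairing of v(xi, zeta(xi)), cut off to J, with phi: the series defining v
   is integrated term by term. *)
Definition v_coef (J : set R) (zeta : R -> R) (phi : R -> R[i]) (n : int)
    : R[i] :=
  cintegral J (fun xi =>
    phi xi * cexp ('i%C * (2 * pi * n%:~R * xi)%:C
                   - 'i%C * (pi * n%:~R ^+ 2 * zeta xi)%:C)).

Definition v_pairing (J : set R) (zeta : R -> R) (phi : R -> R[i]) : R[i] :=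
  zsum (v_coef J zeta phi).

Definition v_pairing_defined (J : set R) (zeta : R -> R) (phi : R -> R[i])
    : Prop :=
  zsummable (v_coef J zeta phi).

(* The functions f r, cut off to J, converge to v(xi, zeta(xi)), cut off to J,
   when tested against phi; all the pairings involved make sense. *)
Definition cvg_to_v (J : set R) (f : R -> R -> R[i]) (zeta : R -> R)
    (phi : R -> R[i]) : Prop :=
  [/\ forall r : R, 0 < r -> fun_pairing_defined J (f r) phi,
      v_pairing_defined J zeta phi
    & ccvg_pinfty (fun r => fun_pairing J (f r) phi) (v_pairing J zeta phi)].

End Complex.

(* Main.v *)
Require Import Defs.
From HB Require Import structures.
From mathcomp Require Import all_boot all_order all_algebra.
From mathcomp Require Import complex.
From mathcomp Require Import all_classical all_reals all_analysis.
From mathcomp Require Import measurable_realfun.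
From mathcomp Require Import ring lra.

Set Implicit Arguments.
Unset Strict Implicit.
Unset Printing Implicit Defensive.

Import Order.TTheory GRing.Theory Num.Theory.
Import numFieldNormedType.Exports.

Local Open Scope classical_set_scope.
Local Open Scope complex_scope.
Local Open Scope ring_scope.

(** Along the line zeta = m xi - k, the n-th term of the series defining w_r is
    the wave exp (2 pi i (n xi - lam zeta)) whose dispersion lam = lam_n(r) is
    r ^ 2 (1 - sqrt (1 - (n / r) ^ 2)), while the n-th term of v is the wave of
    dispersion n ^ 2 / 2.  For a fixed n, lam_n(r) tends to n ^ 2 / 2 as r grows,
    so each integral of phi against a wave converges ([wave_coef_lipschitz],
    [real_dispersion_bound]).  What remains is a domination argument.

    On the half-line where zeta > 0, one integration by parts bounds the integral
    of phi against a wave by C / |n - m lam|, the boundary term at k / m included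
    ([wave_coef_parts]).  Since |lam_n(r)| >= n ^ 2 / 4 for |n| <= r + 1 and
    r >= 1, these integrals are O(1 / (1 + n ^ 2)) uniformly in r ([wave_coef_bound]), and
    Tannery's theorem ([tannery]) gives the convergence of the sum over the
    propagating modes and the first evanescent ones.  The same bound makes the
    pairing of v with phi absolutely convergent.

    This bound is too weak for the other evanescent modes, where |lam| is only
    r |n|.  Up to a common phase, their sum is the real series
    sum of 2 cos (2 pi n xi) exp (- a_n zeta), with a_n nondecreasing in n.
    Comparison with a geometric series bounds it by 1 / (pi r zeta)
    ([tail_le]), and summation by parts by 2 / |sin (pi xi)| ([sin_tail_le]).
    The first bound is not integrable at k / m.  If k / m is not an integer, the
    second one controls a neighbourhood of k / m; if it is, phi vanishes at k / m
    and phi / zeta is integrable.  In both cases the integral of the product with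
    phi is at most C eta + C / (r eta) for every eta in (0, 1], and it tends to 0
    ([remainder_bound]).

    A line of negative slope is treated together with a line of positive slope, as
    only the half-line where m xi - k > 0 matters.  On the whole line the two
    half-lines are added, w and |zeta| being unchanged when (m, k) is replaced by
    (- m, - k). *)

(** * Complex numbers *)

Section ComplexNumbers.
Variable R : realType.
Implicit Types (x y : R) (z c : R[i]).
Local Notation Re := (@complex.Re R).
Local Notation Im := (@complex.Im R).

Lemma cReD z c : Re (z + c) = Re z + Re c. Proof. by case: z; case: c. Qed.
Lemma cImD z c : Im (z + c) = Im z + Im c. Proof. by case: z; case: c. Qed.
Lemma cReN z : Re (- z) = - Re z. Proof. by case: z. Qed.
Lemma cImN z : Im (- z) = - Im z. Proof. by case: z. Qed.
Lemma cReM z c : Re (z * c) = Re z * Re c - Im z * Im c.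
Proof. by case: z; case: c. Qed.
Lemma cImM z c : Im (z * c) = Re z * Im c + Im z * Re c.
Proof. by case: z; case: c. Qed.

Lemma cRe_sum (I : Type) (s : seq I) (P : pred I) (F : I -> R[i]) :
  Re (\sum_(i <- s | P i) F i) = \sum_(i <- s | P i) Re (F i).
Proof. by apply: (big_morph Re) => // z c; rewrite cReD. Qed.

Lemma cIm_sum (I : Type) (s : seq I) (P : pred I) (F : I -> R[i]) :
  Im (\sum_(i <- s | P i) F i) = \sum_(i <- s | P i) Im (F i).
Proof. by apply: (big_morph Im) => // z c; rewrite cImD. Qed.

Lemma complexP z c : Re z = Re c -> Im z = Im c -> z = c.
Proof. by case: z => a b; case: c => a' b' /= -> ->. Qed.

(** The real-valued norm |Re z| + |Im z|, equivalent to the modulus. *)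
Definition cnorm1 z : R := `|Re z| + `|Im z|.

Lemma cnorm1_ge0 z : 0 <= cnorm1 z.
Proof. by rewrite /cnorm1 addr_ge0. Qed.

Lemma cnorm1_Re z : `|Re z| <= cnorm1 z.
Proof. by rewrite /cnorm1 lerDl. Qed.

Lemma cnorm1_Im z : `|Im z| <= cnorm1 z.
Proof. by rewrite /cnorm1 lerDr. Qed.

Lemma cnorm10 : cnorm1 0 = 0.
Proof. by rewrite /cnorm1 /= normr0 addr0. Qed.

Lemma cnorm1N z : cnorm1 (- z) = cnorm1 z.
Proof. by rewrite /cnorm1 cReN cImN !normrN. Qed.

Lemma cnorm1D z c : cnorm1 (z + c) <= cnorm1 z + cnorm1 c.
Proof.
rewrite /cnorm1 cReD cImD.
have := ler_normD (Re z) (Re c); have := ler_normD (Im z) (Im c); lra.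
Qed.

Lemma cnorm1B z c : cnorm1 (z - c) <= cnorm1 z + cnorm1 c.
Proof. by rewrite (le_trans (cnorm1D _ _))// cnorm1N. Qed.

Lemma cnorm1_sum (I : Type) (s : seq I) (P : pred I) (F : I -> R[i]) :
  cnorm1 (\sum_(i <- s | P i) F i) <= \sum_(i <- s | P i) cnorm1 (F i).
Proof.
apply: (big_ind2 (fun z y => cnorm1 z <= y)) => //; first by rewrite cnorm10.
by move=> z1 y1 z2 y2 h1 h2; rewrite (le_trans (cnorm1D _ _))// lerD.
Qed.

Lemma cnorm1M z c : cnorm1 (z * c) <= cnorm1 z * cnorm1 c.
Proof.
rewrite /cnorm1 cReM cImM.
have := ler_normB (Re z * Re c) (Im z * Im c).
have := ler_normD (Re z * Im c) (Im z * Re c).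
rewrite !normrM mulrDl !mulrDr; lra.
Qed.

Lemma cnorm1_real x : cnorm1 x%:C = `|x|.
Proof. by rewrite /cnorm1 /= normr0 addr0. Qed.

(** Up to a factor, the norm of a product controls the product of the norms. *)
Lemma cnorm1M_ge z c : cnorm1 c * cnorm1 z <= 2 * cnorm1 (c * z).
Proof.
case: z => x y; case: c => a b; rewrite /cnorm1 /=.
set X := a * x - b * y; set Y := a * y + b * x.
have hx : `|x| * (a ^+ 2 + b ^+ 2) <= `|a| * `|X| + `|b| * `|Y|.
  rewrite -(ger0_norm (_ : 0 <= a ^+ 2 + b ^+ 2)); last by rewrite addr_ge0 ?sqr_ge0.
  rewrite -!normrM; have -> : x * (a ^+ 2 + b ^+ 2) = a * X + b * Y.
    by rewrite /X /Y; ring.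
  exact: ler_normD.
have hy : `|y| * (a ^+ 2 + b ^+ 2) <= `|a| * `|Y| + `|b| * `|X|.
  rewrite -(ger0_norm (_ : 0 <= a ^+ 2 + b ^+ 2)); last by rewrite addr_ge0 ?sqr_ge0.
  rewrite -!normrM; have -> : y * (a ^+ 2 + b ^+ 2) = a * Y - b * X.
    by rewrite /X /Y; ring.
  exact: ler_normB.
have ha : a ^+ 2 = `|a| ^+ 2 by rewrite real_normK ?num_real.
have hb : b ^+ 2 = `|b| ^+ 2 by rewrite real_normK ?num_real.
rewrite ha hb in hx hy.
have [s0|s0] := eqVneq (`|a| + `|b|) 0.
  by rewrite s0 mul0r mulr_ge0 ?addr_ge0.
have sp : 0 < `|a| + `|b| by rewrite lt0r s0 addr_ge0.
rewrite -(ler_pM2l sp).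
have := normr_ge0 x; have := normr_ge0 y; have := normr_ge0 X.
have := normr_ge0 Y; have := normr_ge0 a; have := normr_ge0 b.
move: (`|a|) (`|b|) (`|x|) (`|y|) (`|X|) (`|Y|) hx hy {ha hb s0 sp}.
move=> A B U V P Q hx hy B0 A0 Q0 P0 V0 U0.
have : 0 <= (A - B) ^+ 2 * (U + V) by rewrite mulr_ge0 ?sqr_ge0// addr_ge0.
nra.
Qed.

Lemma cexpD z c : cexp (z + c) = cexp z * cexp c.
Proof.
by apply: complexP; rewrite ?cReM ?cImM /cexp /= cReD cImD expRD ?cosD ?sinD; ring.
Qed.

Lemma cnorm1_cexp z : Re z <= 0 -> cnorm1 (cexp z) <= 2.
Proof.
move=> z0; rewrite /cnorm1 /cexp /= !normrM.
have e1 : `|expR (Re z)| <= 1 by rewrite ger0_norm ?expR_ge0// -expR0 ler_expR.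
have := cos_max (Im z); have := sin_max (Im z).
have := normr_ge0 (expR (Re z)).
have := normr_ge0 (cos (Im z)); have := normr_ge0 (sin (Im z)).
nra.
Qed.

(** Convergence of both components follows from convergence in cnorm1. *)
Lemma ccvg_pinftyP (F : R -> R[i]) (l : R[i]) :
  (forall e : R, 0 < e -> \forall r \near +oo, cnorm1 (F r - l) <= e) ->
  ccvg_pinfty F l.
Proof.
move=> h; split; apply/cvgrPdist_le => e e0; have := h e e0;
  apply: filterS => r; apply: le_trans.
- by rewrite distrC -cReN -cReD cnorm1_Re.
- by rewrite distrC -cImN -cImD cnorm1_Im.
Qed.

End ComplexNumbers.

(** * Series indexed by the integers *)

Section Series.
Variable R : realType.
Local Notation Re := (@complex.Re R).
Local Notation Im := (@complex.Im R).

(** Summation by parts against a bounded sequence of increments. *)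
Lemma abel_bound (a b : nat -> R) (M : nat) :
  (forall j, 0 <= a j) -> (forall j, a j.+1 <= a j) -> (forall j, `|b j| <= 1) ->
  `|\sum_(0 <= j < M) a j * (b j.+1 - b j)| <= 2 * a 0%N.
Proof.
move=> a0 da b1.
(* The boundary term a M * b M is subtracted so that the bound can be proved
   by induction: each step adds (a M - a M.+1) * b M.+1. *)
suff : `|\sum_(0 <= j < M) a j * (b j.+1 - b j) - a M * b M| <= 2 * a 0%N - a M.
  have : `|a M * b M| <= a M by rewrite normrM ger0_norm// ler_piMr.
  have := ler_normD (\sum_(0 <= j < M) a j * (b j.+1 - b j) - a M * b M) (a M * b M).
  rewrite subrK; lra.
elim: M => [|M IH].
  rewrite big_geq// sub0r normrN normrM ger0_norm//.
  have := ler_wpM2l (a0 0%N) (b1 0%N); lra.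
rewrite big_nat_recr//=.
have -> : \sum_(0 <= i < M) a i * (b i.+1 - b i) + a M * (b M.+1 - b M) -
  a M.+1 * b M.+1 = (\sum_(0 <= i < M) a i * (b i.+1 - b i) - a M * b M) +
  (a M - a M.+1) * b M.+1 by ring.
rewrite (le_trans (ler_normD _ _))// normrM.
have d0 : 0 <= a M - a M.+1 by rewrite subr_ge0.
rewrite (ger0_norm d0); have := ler_wpM2l d0 (b1 M.+1); lra.
Qed.

(** A cosine series with nonincreasing coefficients is bounded, uniformly in
    the number of terms, where sin (pi x) does not vanish. *)
Lemma abel_cos_bound (a : nat -> R) (x : R) (n0 M : nat) :
  (forall j, 0 <= a j) -> (forall j, a j.+1 <= a j) ->
  `|sin (pi * x) * \sum_(0 <= j < M) 2 * cos (2 * pi * (n0 + j)%:R * x) * a j|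
    <= 2 * a 0%N.
Proof.
move=> a0 da.
(* 2 sin (pi x) cos (2 pi n x) is the increment of sin ((2 n - 1) pi x). *)
pose b j : R := sin (2 * pi * (n0 + j)%:R * x - pi * x).
rewrite mulr_sumr (eq_bigr (fun j => a j * (b j.+1 - b j))); last first.
  move=> j _; rewrite /b.
  have -> : 2 * pi * (n0 + j.+1)%:R * x - pi * x = 2 * pi * (n0 + j)%:R * x + pi * x.
    by rewrite addnS -natr1; ring.
  rewrite sinD sinB; ring.
by apply: abel_bound => // j; exact: sin_max.
Qed.

Lemma geometric_expR_bound (t : R) (M : nat) : 0 < t ->
  \sum_(0 <= j < M) expR (- (t * j.+1%:R)) <= t^-1.
Proof.
move=> t0; rewrite -(ler_pM2l t0) mulfV ?gt_eqF//.
(* Telescoping, since t <= exp t - 1. *)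
suff : t * \sum_(0 <= j < M) expR (- (t * j.+1%:R)) <= 1 - expR (- (t * M%:R)).
  by have := expR_ge0 (- (t * M%:R)); lra.
elim: M => [|M IH]; first by rewrite big_geq// !mulr0 oppr0 expR0 subrr.
rewrite big_nat_recr//= mulrDr.
suff : t * expR (- (t * M.+1%:R)) <= expR (- (t * M%:R)) - expR (- (t * M.+1%:R)) by lra.
have -> : - (t * M%:R) = - (t * M.+1%:R) + t by rewrite -natr1; ring.
rewrite expRD; have := expR_ge1Dx t; have := expR_ge0 (- (t * M.+1%:R)); nra.
Qed.

Lemma sum_oneDsqrV_tail (M k : nat) : (0 < M)%N ->
  \sum_(M.+1 <= n < M.+1 + k) (1 + n%:R ^+ 2)^-1 <= M%:R^-1 - (M + k)%:R^-1 :> R.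
Proof.
move=> M0; elim: k => [|k IH]; first by rewrite addn0 big_geq// addn0 subrr.
rewrite addnS big_nat_recr ?leq_addr//=.
suff : (1 + (M.+1 + k)%:R ^+ 2)^-1 <= (M + k)%:R^-1 - (M + k.+1)%:R^-1 :> R by lra.
rewrite addSn addnS; set n := (M + k)%N.
have n0 : (0 : R) < n%:R by rewrite ltr0n addn_gt0 M0.
rewrite -natr1; set y : R := n%:R in n0 *.
have -> : y^-1 - (y + 1)^-1 = (y * (y + 1))^-1.
  by field; rewrite !gt_eqF//; lra.
rewrite lef_pV2 ?posrE; nra.
Qed.

Lemma sum_oneDsqrV_le (M P : nat) : (0 < M)%N ->
  \sum_(M.+1 <= n < P) (1 + n%:R ^+ 2)^-1 <= M%:R^-1 :> R.
Proof.
move=> M0; have [PM|MP] := leqP P M.+1; first by rewrite big_geq// invr_ge0.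
rewrite -(subnKC (ltnW MP)); apply: le_trans (sum_oneDsqrV_tail _ M0) _.
by rewrite gerBl invr_ge0.
Qed.

Lemma oneDsqr_gt0 (x : R) : 0 < 1 + x ^+ 2.
Proof. by have := sqr_ge0 x; lra. Qed.

Lemma sum_oneDsqrV_le3 (n : nat) :
  \sum_(0 <= j < n) (1 + j%:R ^+ 2)^-1 <= 3 :> R.
Proof.
have i0 (j : nat) : 0 <= (1 + j%:R ^+ 2)^-1 :> R.
  by rewrite invr_ge0 ltW// oneDsqr_gt0.
have i1 (j : nat) : (1 + j%:R ^+ 2)^-1 <= 1 :> R.
  by rewrite invf_le1 ?oneDsqr_gt0// lerDl sqr_ge0.
case: n => [|[|n]]; first by rewrite big_geq.
  by rewrite big_nat1; have := i1 0%N; lra.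
rewrite big_ltn// big_ltn//.
have := @sum_oneDsqrV_le 1 n.+2 isT; rewrite invr1.
have := i1 0%N; have := i1 1%N; lra.
Qed.

(** The terms of index n and - n of a family, put together. *)
Definition zpair (V : zmodType) (u : int -> V) (n : nat) : V :=
  if n == 0%N then u 0 else u n%:Z + u (- n%:Z).

Lemma sum_zpair (V : zmodType) (u : int -> V) (N : nat) :
  u 0 + \sum_(1 <= n < N.+1) (u n%:Z + u (- n%:Z)) = \sum_(0 <= n < N.+1) zpair u n.
Proof.
rewrite [RHS]big_ltn//; congr (_ + _); apply: eq_big_nat => n /andP[n1 _].
by rewrite /zpair gtn_eqF.
Qed.

Lemma zpair_bound (u : int -> R) (D : R) (n : nat) :
  (forall k : int, `|u k| <= D / (1 + k%:~R ^+ 2)) ->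
  `|zpair u n| <= 2 * D / (1 + n%:R ^+ 2).
Proof.
move=> h; rewrite /zpair; case: eqP => [->|_].
  have := h 0; rewrite expr0n/= => h0; have := normr_ge0 (u 0).
  by rewrite addr0 invr1 !mulr1 in h0 *; lra.
have := h n%:Z; have := h (- n%:Z).
rewrite rmorphN/= sqrrN -pmulrn => h1 h2.
by have := ler_normD (u n%:Z) (u (- n%:Z)); lra.
Qed.

(** A family dominated by 1 / (1 + n ^ 2) has convergent symmetric partial sums,
    so that the limit defining zsumR exists. *)
Lemma cvg_zsumR (u : int -> R) (D : R) :
  (forall k : int, `|u k| <= D / (1 + k%:~R ^+ 2)) ->
  \sum_(0 <= n < N.+1) zpair u n @[N --> \oo] --> zsumR u.
Proof.
move=> h.
have -> : zsumR u = limn (fun N => \sum_(0 <= n < N.+1) zpair u n).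
  by rewrite /zsumR; congr (limn _); apply/funext => N; rewrite sum_zpair.
have D0 : 0 <= D.
  by have := h 0; rewrite expr0n/= addr0 invr1 mulr1; apply: le_trans.
suff : cvgn (series (zpair u)).
  move=> cv; have /= := cvg_comp _ _ (cvg_addnr 1) cv.
  rewrite /comp; under eq_fun do rewrite addn1.
  by move=> cv'; apply/cvg_ex; eexists; exact: cv'.
apply: normed_cvg.
apply: (@series_le_cvg _ _ (fun n => 2 * D * (1 + n%:R ^+ 2)^-1)).
- by move=> n; exact: normr_ge0.
- by move=> n; rewrite !mulr_ge0// invr_ge0 ltW// oneDsqr_gt0.
- by move=> n; exact: zpair_bound.
apply: nondecreasing_is_cvgn.
  apply/nondecreasing_seqP => n; rewrite /series/= big_nat_recr//= lerDl.
  by rewrite !mulr_ge0// invr_ge0 ltW// oneDsqr_gt0.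
exists (2 * D * 3) => _ [n _ <-]; rewrite /series/= -mulr_sumr ler_wpM2l ?mulr_ge0//.
exact: sum_oneDsqrV_le3.
Qed.

Lemma summable_int (u : int -> R) (D : R) :
  (forall k : int, `|u k| <= D / (1 + k%:~R ^+ 2)) ->
  summable [set: int] (fun n => (u n)%:E).
Proof.
move=> h; rewrite /summable.
have D0 : 0 <= D.
  by have := h 0; rewrite expr0n/= addr0 invr1 mulr1; apply: le_trans.
(* Each of the two halves of the integers is enumerated by the naturals. *)
have half (e : nat -> int) : injective e ->
    (forall n : nat, n%:R ^+ 2 <= (e n)%:~R ^+ 2 :> R) ->
    (\esum_(i in range e) `|(u i)%:E| <= (D * 3)%:E)%E.
  move=> inje en.
  rewrite esum_image; last by move=> x y _ _; exact: inje.
  rewrite -nneseries_esumT; last by move=> n; exact: abse_ge0.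
  apply: lime_le; first exact: is_cvg_nneseries.
  apply: nearW => N; rewrite [X in (X <= _)%E](_ : _ = (\sum_(0 <= i < N) `|u (e i)|)%:E).
    rewrite lee_fin; apply: le_trans (_ : \sum_(0 <= i < N) D * (1 + i%:R ^+ 2)^-1 <= _).
      apply: ler_sum_nat => i _; apply: le_trans (h _) _.
      rewrite ler_wpM2l// lef_pV2 ?posrE ?oneDsqr_gt0//; have := en i; lra.
    rewrite -mulr_sumr ler_wpM2l//; exact: sum_oneDsqrV_le3.
  by rewrite -sumEFin; apply: eq_bigr => i _; rewrite abse_EFin.
rewrite (esumID [set n : int | 0 <= n]); last by move=> i _; exact: abse_ge0.
rewrite !setTI.
have -> : [set n : int | 0 <= n] = range Posz.
  apply/seteqP; split => [[n|n]//= _|_ [n _ <-]//]; by exists n.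
have -> : ~` range Posz = range Negz.
  apply/seteqP; split => [[n|n]/= hn|_ [n _ <-] [m _]//]; last by exists n.
  by exfalso; apply: hn; exists n.
apply: (@le_lt_trans _ _ ((D * 3)%:E + (D * 3)%:E)%E); last exact: ltry.
apply: leeD; apply: half.
- by move=> m n [].
- by move=> n; rewrite pmulrn.
- by move=> m n [].
- move=> n; rewrite NegzE rmorphN/= sqrrN -pmulrn ler_sqr ?nnegrE//.
  by rewrite ler_nat.
Qed.

(** Tannery's theorem: limits pass through sums with a common summable
    majorant, here for sums whose number of terms grows with r. *)
Lemma tannery (A : R -> nat -> R[i]) (V : nat -> R[i]) (L : R[i])
    (N : R -> nat) (D : R) :
  (forall n (e : R), 0 < e -> \forall r \near +oo, cnorm1 (A r n - V n) <= e) ->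
  (\forall r \near +oo, forall n, (n <= N r)%N ->
     cnorm1 (A r n) <= D / (1 + n%:R ^+ 2)) ->
  (forall n, cnorm1 (V n) <= D / (1 + n%:R ^+ 2)) ->
  (forall M, \forall r \near +oo, (M <= N r)%N) ->
  (forall e : R, 0 < e ->
     \forall M \near \oo, cnorm1 (\sum_(0 <= n < M.+1) V n - L) <= e) ->
  forall e : R, 0 < e ->
    \forall r \near +oo, cnorm1 (\sum_(0 <= n < (N r).+1) A r n - L) <= e.
Proof.
move=> hA hAD hV hN hL e e0.
have e4 : 0 < e / 4 by rewrite divr_gt0.
have D0 : 0 <= D.
  have := hV 0%N; rewrite expr0n/= addr0 invr1 mulr1.
  by apply: le_trans; exact: cnorm1_ge0.
(* M is such that both the tails beyond M of the two sums, bounded by D / M,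
   and the defect of the M-th partial sum of V are small. *)
have [M [M0 MD hM]] : exists M : nat, [/\ (0 < M)%N, D / M%:R <= e / 4 &
    forall M', (M <= M')%N -> cnorm1 (\sum_(0 <= n < M'.+1) V n - L) <= e / 4].
  have [M1 _ hM1] := hL _ e4.
  pose M2 := (Num.bound (D / (e / 4))).
  have M2b : D / (e / 4) < M2%:R.
    by apply: le_lt_trans (archi_boundP _); rewrite ?divr_ge0 ?ler_norm// ltW.
  exists (maxn M1 M2).+1; split => //.
    rewrite ler_pdivrMr// mulrC -ler_pdivrMr//; apply: le_trans (ltW M2b) _.
    by rewrite ler_nat (leq_trans (leq_maxr M1 M2)).
  move=> M' hM'; apply: hM1 => /=.
  by rewrite (leq_trans _ hM')// leqW// leq_maxl.
have hfin : \forall r \near +oo,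
    \sum_(0 <= n < M.+1) cnorm1 (A r n - V n) <= e / 4.
  have eM : 0 < e / 4 / M.+1%:R by rewrite divr_gt0.
  have : \forall r \near +oo, forall n : 'I_M.+1,
      cnorm1 (A r n - V n) <= e / 4 / M.+1%:R.
    by apply: filter_forall => n; exact: hA.
  apply: filterS => r hr; rewrite big_mkord.
  apply: le_trans (ler_sum _ (fun i _ => hr i)) _.
  by rewrite sumr_const card_ord -[leLHS]mulr_natr divfK ?pnatr_eq0.
have hNM := hN M.
near=> r.
have rN : (M <= N r)%N by near: r.
have split_sum (F : nat -> R[i]) : \sum_(0 <= n < (N r).+1) F n =
    \sum_(0 <= n < M.+1) F n + \sum_(M.+1 <= n < (N r).+1) F n.
  by rewrite -(@big_cat_nat _ _ _ M.+1).
have tail (F : nat -> R[i]) :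
    (forall n, (n <= N r)%N -> cnorm1 (F n) <= D / (1 + n%:R ^+ 2)) ->
    cnorm1 (\sum_(M.+1 <= n < (N r).+1) F n) <= e / 4.
  move=> hF; apply: le_trans (cnorm1_sum _ _ _) _; apply: le_trans MD.
  apply: (@le_trans _ _ (\sum_(M.+1 <= n < (N r).+1) D * (1 + n%:R ^+ 2)^-1)).
    by apply: ler_sum_nat => n /andP[_ hn]; exact: hF.
  by rewrite -mulr_sumr ler_wpM2l// sum_oneDsqrV_le.
have -> : \sum_(0 <= n < (N r).+1) A r n - L =
    \sum_(0 <= n < M.+1) (A r n - V n) + \sum_(M.+1 <= n < (N r).+1) A r n +
    (\sum_(0 <= n < M.+1) V n - L).
  by rewrite split_sum sumrB; ring.
apply: le_trans (cnorm1D _ _) _.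
apply: le_trans (lerD (cnorm1D _ _) (lexx _)) _.
have h1 := hM M (leqnn M).
have h2 : cnorm1 (\sum_(0 <= n < M.+1) (A r n - V n)) <= e / 4.
  by apply: le_trans (cnorm1_sum _ _ _) _; near: r.
have h3 : cnorm1 (\sum_(M.+1 <= n < (N r).+1) A r n) <= e / 4.
  by apply: tail; near: r.
lra.
Unshelve. all: by end_near. Qed.

End Series.

(** * Integrals of complex-valued functions and the half-line *)

Section Integration.
Variable R : realType.
Implicit Types (f g h : R -> R) (F G : R -> R[i]) (J A B : set (measurableTypeR R)).
Local Notation Re := (@complex.Re R).
Local Notation Im := (@complex.Im R).
Local Notation mu := (@lebesgue_measure R).

Lemma integrable_le J f g : measurable J -> measurable_fun J f ->
  mu.-integrable J (EFin \o g) -> (forall x, J x -> `|f x| <= g x) ->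
  mu.-integrable J (EFin \o f).
Proof.
move=> mJ mf ig fg; apply: le_integrable ig => //; first exact/measurable_EFinP.
by move=> x Jx /=; rewrite lee_fin (le_trans (fg x Jx))// ler_norm.
Qed.

Lemma cintegrable_le J F g : measurable J ->
  measurable_fun J (Re \o F) -> measurable_fun J (Im \o F) ->
  mu.-integrable J (EFin \o g) -> (forall x, J x -> cnorm1 (F x) <= g x) ->
  cintegrable J F.
Proof.
move=> mJ mr mi ig Fg; split; apply: (@integrable_le J _ g) => // x Jx /=.
- by rewrite (le_trans (cnorm1_Re _))// Fg.
- by rewrite (le_trans (cnorm1_Im _))// Fg.
Qed.

Lemma norm_Rintegral_le J f g : measurable J -> mu.-integrable J (EFin \o f) ->
  mu.-integrable J (EFin \o g) -> (forall x, J x -> `|f x| <= g x) ->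
  `|\int[mu]_(x in J) f x| <= \int[mu]_(x in J) g x.
Proof.
move=> mJ jf ig fg; apply: le_trans (le_normr_Rintegral mJ jf) _.
by apply: le_Rintegral => //; exact: integrable_norm.
Qed.

Lemma cnorm1_cintegral_le J F g : measurable J -> cintegrable J F ->
  mu.-integrable J (EFin \o g) -> (forall x, J x -> cnorm1 (F x) <= g x) ->
  cnorm1 (cintegral J F) <= 2 * \int[mu]_(x in J) g x.
Proof.
move=> mJ [iR iI] ig Fg; rewrite /cnorm1 /cintegral /=.
have h1 : `|\int[mu]_(x in J) Re (F x)| <= \int[mu]_(x in J) g x.
  apply: norm_Rintegral_le => // x Jx; by apply: le_trans (Fg x Jx); exact: cnorm1_Re.
have h2 : `|\int[mu]_(x in J) Im (F x)| <= \int[mu]_(x in J) g x.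
  apply: norm_Rintegral_le => // x Jx; by apply: le_trans (Fg x Jx); exact: cnorm1_Im.
lra.
Qed.

Lemma eq_cintegral J F G : (forall x, J x -> F x = G x) ->
  cintegral J F = cintegral J G.
Proof.
by move=> FG; congr (_ +i* _); apply: eq_Rintegral => x /set_mem Jx; rewrite FG.
Qed.

Lemma eq_cintegrable J F G : measurable J -> (forall x, J x -> F x = G x) ->
  cintegrable J F -> cintegrable J G.
Proof.
move=> mJ FG [iR iI]; split.
- by apply: eq_integrable iR => // x /set_mem Jx; rewrite FG.
- by apply: eq_integrable iI => // x /set_mem Jx; rewrite FG.
Qed.

Lemma cintegrableD J F G : measurable J -> cintegrable J F -> cintegrable J G ->
  cintegrable J (fun x => F x + G x).
Proof.
move=> mJ [fr fi] [gr gi]; split.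
- under eq_fun do rewrite cReD EFinD; exact: integrableD.
- under eq_fun do rewrite cImD EFinD; exact: integrableD.
Qed.

Lemma cintegralD J F G : measurable J -> cintegrable J F -> cintegrable J G ->
  cintegral J (fun x => F x + G x) = cintegral J F + cintegral J G.
Proof.
move=> mJ [fr fi] [gr gi]; apply: complexP; rewrite /cintegral /= -RintegralD//.
- by apply: eq_Rintegral => x _; rewrite cReD.
- by apply: eq_Rintegral => x _; rewrite cImD.
Qed.

Lemma cintegrableMl J F (c : R[i]) : measurable J -> cintegrable J F ->
  cintegrable J (fun x => c * F x).
Proof.
move=> mJ [fr fi]; split.
- under eq_fun do rewrite cReM EFinB 2!EFinM.
  by apply: integrableB => //; exact: integrableZl.
- under eq_fun do rewrite cImM EFinD 2!EFinM.
  by apply: integrableD => //; exact: integrableZl.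
Qed.

Lemma cintegralMl J F (c : R[i]) : measurable J -> cintegrable J F ->
  cintegral J (fun x => c * F x) = c * cintegral J F.
Proof.
move=> mJ [fr fi].
have Z (a : R) f : mu.-integrable J (EFin \o f) ->
    mu.-integrable J (EFin \o (fun x => a * f x)).
  by move=> jf; rewrite /comp; under eq_fun do rewrite EFinM; exact: integrableZl.
apply: complexP; rewrite ?cReM ?cImM /cintegral /=.
- under eq_Rintegral do rewrite cReM.
  by rewrite RintegralB ?RintegralZl//; exact: Z.
- under eq_Rintegral do rewrite cImM.
  by rewrite RintegralD ?RintegralZl//; exact: Z.
Qed.

Lemma cintegrable0 J : cintegrable J (fun=> 0).
Proof. by split; exact: integrable0. Qed.

Lemma cintegral0 J : cintegral J (fun=> 0 : R[i]) = 0.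
Proof. by rewrite /cintegral/= /Rintegral integral0. Qed.

Lemma cintegrable_sum J (F : nat -> R -> R[i]) (N : nat) : measurable J ->
  (forall n, (n < N)%N -> cintegrable J (F n)) ->
  cintegrable J (fun x => \sum_(0 <= n < N) F n x).
Proof.
move=> mJ; elim: N => [_|N IH iF].
  by under eq_fun do rewrite big_geq//; exact: cintegrable0.
under eq_fun do rewrite big_nat_recr//=.
by apply: cintegrableD => //; [apply: IH => n nN; apply: iF; exact: ltnW | exact: iF].
Qed.

Lemma cintegral_sum J (F : nat -> R -> R[i]) (N : nat) : measurable J ->
  (forall n, (n < N)%N -> cintegrable J (F n)) ->
  cintegral J (fun x => \sum_(0 <= n < N) F n x) =
  \sum_(0 <= n < N) cintegral J (F n).
Proof.
move=> mJ; elim: N => [_|N IH iF].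
  by under eq_fun do rewrite big_geq//; rewrite cintegral0 big_geq.
under eq_fun do rewrite big_nat_recr//=.
rewrite cintegralD//.
- by rewrite IH ?big_nat_recr// => n nN; apply: iF; exact: ltnW.
- by apply: cintegrable_sum => // n nN; apply: iF; exact: ltnW.
- exact: iF.
Qed.

Lemma integrable_setU A B f : measurable A -> measurable B -> [disjoint A & B] ->
  mu.-integrable A (EFin \o f) -> mu.-integrable B (EFin \o f) ->
  mu.-integrable (A `|` B) (EFin \o f).
Proof.
move=> mA mB AB /integrableP[fA iA] /integrableP[fB iB].
have mAB : measurable_fun (A `|` B) (EFin \o f) by exact/measurable_funU.
apply/integrableP; split=> //.
rewrite ge0_integral_setU//; first exact: lte_add_pinfty.
by apply: measurableT_comp.
Qed.

Lemma cintegrable_setU A B F : measurable A -> measurable B -> [disjoint A & B] ->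
  cintegrable A F -> cintegrable B F -> cintegrable (A `|` B) F.
Proof. by move=> mA mB AB [Ar Ai] [Br Bi]; split; exact: integrable_setU. Qed.

Lemma cintegral_setU A B F : measurable A -> measurable B -> [disjoint A & B] ->
  cintegrable A F -> cintegrable B F ->
  cintegral (A `|` B) F = cintegral A F + cintegral B F.
Proof.
move=> mA mB AB [Ar Ai] [Br Bi].
by apply: complexP; rewrite /cintegral /= Rintegral_setU//; exact: integrable_setU.
Qed.

Lemma cintegrable_set1 (a : R) F : cintegrable [set a] F.
Proof.
have i1 f : mu.-integrable [set a] (EFin \o f).
  apply: null_set_integrable; [by []| |exact: lebesgue_measure_set1].
  apply/measurable_EFinP.
  exact: (@measurable_fun_set1 _ _ (measurableTypeR R) (measurableTypeR R) a f).
by split; exact: i1.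
Qed.

Lemma cintegral_set1 (a : R) F : cintegral [set a] F = 0.
Proof. by rewrite /cintegral !Rintegral_set1. Qed.

(** An integrable weight, which serves as a majorant in all the estimates. *)
Definition weight (x : R) : R := (1 + x ^+ 2)^-1.

Lemma weight_gt0 x : 0 < weight x.
Proof. by rewrite invr_gt0 oneDsqr_gt0. Qed.

Lemma weight_le1 x : weight x <= 1.
Proof. by rewrite invf_le1 ?oneDsqr_gt0// lerDl sqr_ge0. Qed.

Lemma continuous_weight : continuous weight.
Proof. exact: continuous_oneDsqrV. Qed.

Lemma integrable_weight J : measurable J -> mu.-integrable J (EFin \o weight).
Proof.
move=> mJ; apply: (@integrableS _ _ _ mu setT) => //.
have w0 x : 0 <= weight x by rewrite ltW// weight_gt0.
apply/integrableP; split.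
  apply/measurable_EFinP; apply: continuous_measurable_fun; exact: continuous_weight.
under eq_integral do rewrite /= ger0_norm ?w0//.
rewrite (@ge0_symfun_integralT _ weight) //; last 2 first.
  exact: continuous_weight.
  by move=> x; rewrite /weight /= sqrrN.
rewrite -set_itvcy integral0y_oneDsqr; exact: ltry.
Qed.

Lemma integrable_weightZ J (C : R) : measurable J ->
  mu.-integrable J (EFin \o (fun x => C * weight x)).
Proof.
move=> mJ; rewrite /comp; under eq_fun do rewrite EFinM.
by apply: integrableZl => //; exact: integrable_weight.
Qed.

Lemma cvgy_weight : weight x @[x --> +oo] --> 0.
Proof.
apply/cvgrPdist_le => e e0; near=> x.
rewrite sub0r normrN ger0_norm ?(ltW (weight_gt0 x))//.
have x1 : 1 <= x by near: x; apply: nbhs_pinfty_ge; rewrite num_real.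
have xe : e^-1 <= x by near: x; apply: nbhs_pinfty_ge; rewrite num_real.
rewrite /weight invf_ple ?posrE ?oneDsqr_gt0//; apply: le_trans xe _; nra.
Unshelve. all: by end_near. Qed.

(** The set of the xi at which the line zeta = m xi - k lies in the upper half
    plane: a right half-line from k / m for m > 0, a left one for m < 0. *)
Definition halfline (m k : R) : set R := [set x | 0 < m * x - k].

Lemma halfline_pos (m k : R) : 0 < m -> halfline m k = `]k / m, +oo[%classic.
Proof.
move=> m0; rewrite /halfline; apply/seteqP; split => x /=;
  by rewrite in_itv/= andbT subr_gt0 ltr_pdivrMr// mulrC.
Qed.

Lemma halfline_neg (m k : R) : m < 0 -> halfline m k = `]-oo, k / m[%classic.
Proof.
move=> m0; rewrite /halfline; apply/seteqP; split => x /=;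
  by rewrite in_itv/= subr_gt0 ltr_ndivlMr// mulrC.
Qed.

Lemma measurable_halfline (m k : R) : m != 0 -> measurable (halfline m k).
Proof.
rewrite neq_lt => /orP[m0|m0]; first by rewrite halfline_neg.
by rewrite halfline_pos.
Qed.

(** Fundamental theorem of calculus on a half-line, the primitive vanishing at
    infinity.  Adding a multiple of the weight, whose primitive is the
    arctangent, reduces it to nonnegative integrands. *)
Lemma FTC_right (f g : R -> R) (a C : R) : continuous g ->
  (forall x : R, is_derive x 1 f (g x)) ->
  (forall x, a <= x -> `|f x| <= C * weight x) ->
  (forall x, a <= x -> `|g x| <= C * weight x) ->
  \int[mu]_(x in `]a, +oo[) g x = - f a.
Proof.
move=> cg df fC gC.
have cf : continuous f.
  by move=> x; apply/differentiable_continuous/derivable1_diffP; exact: ex_derive.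
have mi : measurable `[a, +oo[%classic by [].
have ig : mu.-integrable `[a, +oo[ (EFin \o g).
  apply: (@integrable_le _ _ (fun x => C * weight x)) => //.
  - by apply: measurable_funTS; exact: continuous_measurable_fun.
  - exact: integrable_weightZ.
  - by move=> x /=; rewrite in_itv/= andbT; exact: gC.
have iw := integrable_weightZ C mi.
have pos x : a <= x -> 0 <= g x + C * weight x.
  by move=> ax; have := gC x ax; rewrite ler_norml => /andP[]; lra.
have w0 x : a <= x -> 0 <= C * weight x by move=> /gC; apply: le_trans.
have cW (D : R) : continuous (fun x => D * weight x).
  by move=> x; apply: cvgM; [exact: cvg_cst|exact: continuous_weight].
have fy : f x @[x --> +oo] --> 0.
  apply/norm_cvg0P; apply: (@squeeze_cvgr _ _ _ _ (cst 0) (fun x => C * weight x)).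
  - near=> x; rewrite normr_ge0/=; apply: fC; near: x.
    by apply: nbhs_pinfty_ge; rewrite num_real.
  - exact: cvg_cst.
  - by rewrite -[X in _ --> X](mulr0 C); apply: cvgM; [exact: cvg_cst|exact: cvgy_weight].
have dW (x : R) : is_derive x 1 (fun x => C * atan x) (C * weight x).
  by have := is_deriveZ C (is_derive1_atan x).
have FW : \int[mu]_(x in `[a, +oo[) (C * weight x) = C * (pi / 2) - C * atan a.
  apply: (Rintegral_ge0_continuous_FTC2y (F := fun x => C * atan x)) => //.
  - by apply: continuous_subspaceT.
  - by apply: cvgM; [exact: cvg_cst|exact: cvgy_atan].
  - apply: cvg_at_right_filter; apply: cvgM; first exact: cvg_cst.
    exact: continuous_atan.
  - by move=> x _; rewrite derive1E derive_val.
have FG : \int[mu]_(x in `[a, +oo[) (g x + C * weight x) =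
    C * (pi / 2) - (f a + C * atan a).
  have dfW (x : R) : is_derive x 1 (fun x => f x + C * atan x) (g x + C * weight x).
    exact: is_deriveD.
  rewrite (Rintegral_ge0_continuous_FTC2y (F := fun x => f x + C * atan x)
    (l := C * (pi / 2))) => //.
  - apply: continuous_subspaceT => x; apply: cvgD; first exact: cg.
    exact: cW.
  - rewrite -[X in _ --> X]add0r; apply: cvgD => //.
    by apply: cvgM; [exact: cvg_cst|exact: cvgy_atan].
  - apply: cvg_at_right_filter; apply: cvgD; first exact: cf.
    by apply: cvgM; [exact: cvg_cst|exact: continuous_atan].
  - by move=> x _; rewrite derive1E derive_val.
rewrite Rintegral_itv_obnd_cbnd; last first.
  by apply: integrableS ig => // x /=; rewrite !in_itv/= !andbT; exact: ltW.
by move: FG; rewrite RintegralD// FW => FG; lra.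
Unshelve. all: by end_near. Qed.

Lemma ge0_Rintegral_oppr (p : R -> R) (a : R) : continuous p ->
  (forall x, x <= a -> 0 <= p x) ->
  \int[mu]_(x in `]-oo, a]) p x = \int[mu]_(x in `[- a, +oo[) p (- x).
Proof.
move=> cp p0; rewrite /Rintegral; congr fine.
have := @ge0_integration_by_substitutionNy R p (- a); rewrite opprK; apply.
- exact: continuous_subspaceT.
- by move=> x; rewrite in_itv/= => /ltW; exact: p0.
Qed.

Lemma FTC_left (f g : R -> R) (a C : R) : continuous g ->
  (forall x : R, is_derive x 1 f (g x)) ->
  (forall x, x <= a -> `|f x| <= C * weight x) ->
  (forall x, x <= a -> `|g x| <= C * weight x) ->
  \int[mu]_(x in `]-oo, a[) g x = f a.
Proof.
move=> cg df fC gC.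
have mN : measurable (`]-oo, a]%classic : set (measurableTypeR R)) by [].
have mP : measurable (`[- a, +oo[%classic : set (measurableTypeR R)) by [].
have weightN x : weight (- x) = weight x by rewrite /weight sqrrN.
have cgN : continuous (fun x => g (- x)).
  by move=> x; apply: continuous_comp; [exact: continuousN|exact: cg].
have mle x : - a <= x -> - x <= a by rewrite lerNl.
have dfN (x : R) : is_derive x 1 (fun x => - f (- x)) (g (- x)).
  have dN : is_derive x 1 (-%R : R -> R) (-1).
    by have := is_deriveN (is_derive_id x (1 : R)).
  have := is_deriveN (is_derive1_comp (df (- x)) dN).
  by rewrite mulrN1 opprK.
have FR : \int[mu]_(x in `]- a, +oo[) g (- x) = f a.
  rewrite (FTC_right (f := fun x => - f (- x)) (C := C)) ?opprK//.
  - by move=> x ax; rewrite normrN -weightN; apply/fC/mle.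
  - by move=> x ax; rewrite -weightN; apply/gC/mle.
have ig : mu.-integrable `]-oo, a] (EFin \o g).
  apply: (@integrable_le _ _ (fun x => C * weight x)) => //.
  - by apply: measurable_funTS; exact: continuous_measurable_fun.
  - exact: integrable_weightZ.
have igN : mu.-integrable `[- a, +oo[ (EFin \o (fun x => g (- x))).
  apply: (@integrable_le _ _ (fun x => C * weight x)) => //.
  - by apply: measurable_funTS; exact: continuous_measurable_fun.
  - exact: integrable_weightZ.
  - by move=> x /=; rewrite in_itv/= andbT -weightN => ax; apply/gC/mle.
have cW : continuous (fun x => C * weight x).
  by move=> x; apply: cvgM; [exact: cvg_cst|exact: continuous_weight].
have E1 : \int[mu]_(x in `]-oo, a]) (C * weight x) =
    \int[mu]_(x in `[- a, +oo[) (C * weight x).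
  rewrite ge0_Rintegral_oppr//.
    by apply: eq_Rintegral => x _; rewrite weightN.
  by move=> x /gC; apply: le_trans.
have E2 : \int[mu]_(x in `]-oo, a]) (g x + C * weight x) =
    \int[mu]_(x in `[- a, +oo[) (g (- x) + C * weight x).
  rewrite ge0_Rintegral_oppr//.
  - by apply: eq_Rintegral => x _; rewrite weightN.
  - by move=> x; apply: cvgD; [exact: cg|exact: cW].
  - by move=> x /gC; rewrite ler_norml => /andP[]; lra.
rewrite RintegralD// in E2; last exact: integrable_weightZ.
rewrite RintegralD// in E2; last exact: integrable_weightZ.
rewrite Rintegral_itv_bndo_bndc; last first.
  by apply: integrableS ig => // x /=; rewrite !in_itv/=; exact: ltW.
move: FR; rewrite Rintegral_itv_obnd_cbnd; last first.
  by apply: integrableS igN => // x /=; rewrite !in_itv/= !andbT; exact: ltW.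
by move=> <-; lra.
Qed.

Lemma FTC_halfline (m k : R) (f g : R -> R) (C : R) : m != 0 -> continuous g ->
  (forall x : R, is_derive x 1 f (g x)) ->
  (forall x, 0 <= m * x - k -> `|f x| <= C * weight x) ->
  (forall x, 0 <= m * x - k -> `|g x| <= C * weight x) ->
  `|\int[mu]_(x in halfline m k) g x| = `|f (k / m)|.
Proof.
move=> m0 cg df fC gC; have := m0; rewrite neq_lt => /orP[mN|mP].
- have h x : x <= k / m -> 0 <= m * x - k.
    by rewrite ler_ndivlMr// subr_ge0 mulrC.
  by rewrite halfline_neg// (FTC_left (f := f) (C := C))// => x /h; [exact: fC|exact: gC].
- have h x : k / m <= x -> 0 <= m * x - k.
    by rewrite ler_pdivrMr// subr_ge0 mulrC.
  by rewrite halfline_pos// (FTC_right (f := f) (C := C)) ?normrN// => x /h;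
    [exact: fC|exact: gC].
Qed.

(** The fundamental theorem of calculus for complex-valued functions; the norm
    hides the sign, which depends on the orientation of the half-line. *)
Lemma cnorm1_cintegral_derive (m k : R) (F G : R -> R[i]) (C : R) : m != 0 ->
  continuous (Re \o G) -> continuous (Im \o G) ->
  (forall x : R, is_derive x 1 (Re \o F) (Re (G x))) ->
  (forall x : R, is_derive x 1 (Im \o F) (Im (G x))) ->
  (forall x, 0 <= m * x - k -> cnorm1 (F x) <= C * weight x) ->
  (forall x, 0 <= m * x - k -> cnorm1 (G x) <= C * weight x) ->
  cnorm1 (cintegral (halfline m k) G) = cnorm1 (F (k / m)).
Proof.
move=> m0 cr ci dr di FC GC; rewrite /cnorm1 /cintegral /=; congr (_ + _).
- apply: (FTC_halfline (f := Re \o F) (C := C)) => // x h /=.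
    exact: le_trans (cnorm1_Re _) (FC x h).
  exact: le_trans (cnorm1_Re _) (GC x h).
- apply: (FTC_halfline (f := Im \o F) (C := C)) => // x h /=.
    exact: le_trans (cnorm1_Im _) (FC x h).
  exact: le_trans (cnorm1_Im _) (GC x h).
Qed.

End Integration.

(** * Schwartz functions *)

Section Schwartz.
Variable R : realType.
Implicit Types (f : R -> R) (phi : R -> R[i]).
Local Notation Re := (@complex.Re R).
Local Notation Im := (@complex.Im R).
Local Notation mu := (@lebesgue_measure R).

Lemma rschwartz_is_derive f : rschwartz f -> forall x : R, is_derive x 1 f (derive1 f x).
Proof.
by move=> [df _] x; rewrite derive1E; apply: derivableP; exact: (df 0%N x).
Qed.

Lemma rschwartz_continuous f : rschwartz f -> continuous f.
Proof.
move=> [df _] x; apply/differentiable_continuous/derivable1_diffP.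
exact: (df 0%N x).
Qed.

Lemma rschwartz_continuous_derive f : rschwartz f -> continuous (derive1 f).
Proof.
move=> [df _] x; apply/differentiable_continuous/derivable1_diffP.
exact: (df 1%N x).
Qed.

Lemma rschwartz_bound f (n : nat) : rschwartz f ->
  exists2 C, 0 <= C & forall x, (1 + `|x|) * `|derive1n n f x| <= C * weight x.
Proof.
move=> [_ bf]; have [M0 h0] := bf 0%N n; have [M1 h1] := bf 1%N n.
have [M2 h2] := bf 2%N n; have [M3 h3] := bf 3%N n.
exists (`|M0| + `|M1| + `|M2| + `|M3|); first by rewrite !addr_ge0.
move=> x; rewrite /weight ler_pdivlMr ?oneDsqr_gt0//.
have := le_trans (h0 x) (ler_norm M0); have := le_trans (h1 x) (ler_norm M1).
have := le_trans (h2 x) (ler_norm M2); have := le_trans (h3 x) (ler_norm M3).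
rewrite !normrM !normrX expr0 expr1 mul1r -[x ^+ 2]real_normK ?num_real//.
move: (`|x|) (`|derive1n n f x|) => a b; nra.
Qed.

(** The derivative of a complex-valued function, component by component. *)
Definition cderive1 phi (x : R) : R[i] :=
  derive1 (Re \o phi) x +i* derive1 (Im \o phi) x.

(** The three bounds used below; the factor 1 + |x| serves to absorb the height
    |m x - k| of the line. *)
Lemma schwartz_bound phi : schwartz phi -> exists2 C, 0 <= C &
  [/\ forall x, (1 + `|x|) * cnorm1 (phi x) <= C * weight x,
      forall x, cnorm1 (phi x) <= C * weight x &
      forall x, cnorm1 (cderive1 phi x) <= C * weight x].
Proof.
move=> [sr si].
have [C1 C10 h1] := rschwartz_bound 0 sr; have [C2 C20 h2] := rschwartz_bound 0 si.
have [C3 C30 h3] := rschwartz_bound 1 sr; have [C4 C40 h4] := rschwartz_bound 1 si.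
exists (C1 + C2 + C3 + C4); first by rewrite !addr_ge0.
have h1' x : (1 + `|x|) * `|Re (phi x)| <= C1 * weight x := h1 x.
have h2' x : (1 + `|x|) * `|Im (phi x)| <= C2 * weight x := h2 x.
have h3' x : (1 + `|x|) * `|derive1 (Re \o phi) x| <= C3 * weight x := h3 x.
have h4' x : (1 + `|x|) * `|derive1 (Im \o phi) x| <= C4 * weight x := h4 x.
have aux (x a c : R) : 0 <= a -> (1 + `|x|) * a <= c -> a <= c.
  by move=> a0; apply: le_trans; rewrite ler_peMl// lerDl.
split=> x; rewrite /cnorm1 /=; have w0 := ltW (weight_gt0 x).
- have := h1' x; have := h2' x.
  by have := mulr_ge0 C30 w0; have := mulr_ge0 C40 w0; lra.
- have := aux _ _ _ (normr_ge0 _) (h1' x); have := aux _ _ _ (normr_ge0 _) (h2' x).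
  by have := mulr_ge0 C30 w0; have := mulr_ge0 C40 w0; lra.
- have := aux _ _ _ (normr_ge0 _) (h3' x); have := aux _ _ _ (normr_ge0 _) (h4' x).
  by have := mulr_ge0 C10 w0; have := mulr_ge0 C20 w0; lra.
Qed.

(** A Schwartz function vanishing at x0 can be divided by |x - x0| without
    losing integrability: by the mean value theorem near x0, trivially far
    from it. *)
Lemma rschwartz_vanish f (x0 : R) : rschwartz f -> f x0 = 0 ->
  exists2 C, 0 <= C & forall x, `|f x| <= C * `|x - x0| * weight x.
Proof.
move=> sf f0; have [C C0 hC] := rschwartz_bound 0 sf.
have [D D0 hD] := rschwartz_bound 1 sf.
have df := rschwartz_is_derive sf.
have cf : continuous f := rschwartz_continuous sf.
have lip x : `|f x| <= D * `|x - x0|.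
  have d1 y : `|derive1 f y| <= D.
    have := hD y; have := weight_le1 y; have := normr_ge0 y.
    rewrite derive1n1; have := normr_ge0 (derive1 f y); nra.
  have step a b : a <= b -> `|f b - f a| <= D * (b - a).
    move=> ab; have [c _ ->] := MVT_segment ab (fun y _ => df y)
      (continuous_subspaceT cf).
    by rewrite normrM (ger0_norm (_ : 0 <= b - a)) ?subr_ge0// ler_wpM2r ?subr_ge0.
  have [xx0|xx0] := leP x x0.
    have := step _ _ xx0; rewrite f0 sub0r normrN => /le_trans; apply.
    by rewrite ler_wpM2l// distrC ler_norm.
  have := step _ _ (ltW xx0); rewrite f0 subr0 => /le_trans; apply.
  by rewrite ler_wpM2l// ler_norm.
set B := 1 + (`|x0| + 1) ^+ 2.
have B0 : 0 < B by rewrite /B oneDsqr_gt0.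
exists (C + D * B); first by rewrite addr_ge0// mulr_ge0// ltW.
move=> x; have wp := weight_gt0 x.
have [x1|x1] := leP `|x - x0| 1.
  have Bw : 1 <= B * weight x.
    rewrite /weight ler_pdivlMr ?oneDsqr_gt0// mul1r lerD2l -[x ^+ 2]real_normK ?num_real//.
    rewrite lerXn2r ?nnegrE ?addr_ge0//.
    by have := ler_normD (x - x0) x0; rewrite subrK; lra.
  have := lip x; have := normr_ge0 (x - x0).
  move: (`|f x|) (`|x - x0|) (weight x) wp Bw => a b w w0 Bw b0 h.
  have : D * b * 1 <= D * b * (B * w) by rewrite ler_wpM2l// mulr_ge0.
  have : 0 <= C * b * w by rewrite !mulr_ge0// ltW.
  lra.
have := hC x; rewrite derive1n0; have := normr_ge0 x; have := normr_ge0 (f x).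
move: (`|f x|) (`|x|) (`|x - x0|) (weight x) wp x1 => a b c w w0 c1 a0 b0 h.
have c0 : 0 <= c by apply: le_trans ler01 _; exact: ltW.
have B0' := ltW B0; have w0' := ltW w0.
have : 0 <= D * B * c * w by rewrite !mulr_ge0.
have : C * w * 1 <= C * w * c by rewrite ler_wpM2l ?mulr_ge0// ltW.
have : 0 <= b * a by rewrite mulr_ge0.
lra.
Qed.

Lemma schwartz_vanish phi (x0 : R) : schwartz phi -> phi x0 = 0 ->
  exists2 C, 0 <= C & forall x, cnorm1 (phi x) <= C * `|x - x0| * weight x.
Proof.
move=> [sr si] p0.
have [C C0 hC] := rschwartz_vanish sr (congr1 Re p0).
have [D D0 hD] := rschwartz_vanish si (congr1 Im p0).
exists (C + D); first by rewrite addr_ge0.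
by move=> x; rewrite /cnorm1; have := hC x; have := hD x; lra.
Qed.

End Schwartz.

(** * Waves along a line and integration by parts *)

Section Wave.
Variables (R : realType) (m k : R).
Implicit Types (phi : R -> R[i]) (n : int) (l : R[i]).
Local Notation Re := (@complex.Re R).
Local Notation Im := (@complex.Im R).
Local Notation mu := (@lebesgue_measure R).
Local Notation J := (halfline m k).

(** The wave exp (2 pi i (n xi - l zeta)) of frequency n and dispersion l,
    on the line zeta = m xi - k. *)
Definition wave n l (x : R) : R[i] :=
  cexp ((2 * pi * Im l * (m * x - k)) +i*
        (2 * pi * (n%:~R * x - Re l * (m * x - k)))).

(** The logarithmic derivative of the wave. *)
Definition wave_rate n l : R[i] :=
  (2 * pi * m * Im l) +i* (2 * pi * (n%:~R - m * Re l)).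

Lemma cnorm1_wave n l x : Im l <= 0 -> 0 <= m * x - k -> cnorm1 (wave n l x) <= 2.
Proof.
move=> l0 x0; apply: cnorm1_cexp => /=.
by rewrite mulr_le0_ge0// mulr_ge0_le0// mulr_ge0// pi_ge0.
Qed.

Lemma is_derive_affine (a b x : R) : is_derive x 1 (fun x => a * x + b) a.
Proof.
have := is_deriveD (is_deriveZ a (is_derive_id x (1 : R))) (is_derive_cst b x 1).
by rewrite addr0 /GRing.scale /= mulr1.
Qed.

Lemma is_derive_wave n l (x : R) :
  is_derive x 1 (Re \o wave n l) (Re (wave_rate n l * wave n l x)) /\
  is_derive x 1 (Im \o wave n l) (Im (wave_rate n l * wave n l x)).
Proof.
pose p (x : R) := 2 * pi * Im l * m * x + - (2 * pi * Im l * k).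
pose q (x : R) := 2 * pi * (n%:~R - Re l * m) * x + 2 * pi * (Re l * k).
have pE (y : R) : 2 * pi * Im l * (m * y - k) = p y by rewrite /p; ring.
have qE (y : R) : 2 * pi * (n%:~R * y - Re l * (m * y - k)) = q y.
  by rewrite /q; ring.
have -> : Re \o wave n l = (fun x => expR (p x) * cos (q x)).
  by apply/funext => y; rewrite /= pE qE.
have -> : Im \o wave n l = (fun x => expR (p x) * sin (q x)).
  by apply/funext => y; rewrite /= pE qE.
have dp := is_derive_affine (2 * pi * Im l * m) (- (2 * pi * Im l * k)) x.
have dq := is_derive_affine (2 * pi * (n%:~R - Re l * m)) (2 * pi * (Re l * k)) x.
have de := is_derive1_comp (is_derive_expR (p x)) dp.
have dc := is_derive1_comp (is_derive_cos (q x)) dq.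
have ds := is_derive1_comp (is_derive_sin (q x)) dq.
split.
- apply: (is_derive_eq (is_deriveM de dc)).
  rewrite /wave /= pE qE /GRing.scale /=; ring.
- apply: (is_derive_eq (is_deriveM de ds)).
  rewrite /wave /= pE qE /GRing.scale /=; ring.
Qed.

Lemma continuous_wave n l :
  continuous (Re \o wave n l) /\ continuous (Im \o wave n l).
Proof.
split=> x; apply/differentiable_continuous/derivable1_diffP;
  have [h1 h2] := is_derive_wave n l x; exact: ex_derive.
Qed.

Lemma continuousM_wave phi n l :
  continuous (Re \o phi) -> continuous (Im \o phi) ->
  continuous (Re \o (fun x => phi x * wave n l x)) /\
  continuous (Im \o (fun x => phi x * wave n l x)).
Proof.
move=> cr ci; have [wr wi] := continuous_wave n l; split.
- have -> : Re \o (fun x => phi x * wave n l x) =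
    (fun x => (Re \o phi) x * (Re \o wave n l) x - (Im \o phi) x * (Im \o wave n l) x).
    by apply/funext => x; rewrite /= cReM.
  by move=> x; apply: cvgB; apply: cvgM; [exact: cr|exact: wr|exact: ci|exact: wi].
- have -> : Im \o (fun x => phi x * wave n l x) =
    (fun x => (Re \o phi) x * (Im \o wave n l) x + (Im \o phi) x * (Re \o wave n l) x).
    by apply/funext => x; rewrite /= cImM.
  by move=> x; apply: cvgD; apply: cvgM; [exact: cr|exact: wi|exact: ci|exact: wr].
Qed.

Lemma cintegrable_wave phi n l (C : R) : m != 0 ->
  continuous (Re \o phi) -> continuous (Im \o phi) ->
  (forall x, cnorm1 (phi x) <= C * weight x) -> Im l <= 0 ->
  cintegrable J (fun x => phi x * wave n l x).
Proof.
move=> m0 cr ci hC l0; have mJ := measurable_halfline k m0.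
have [c1 c2] := continuousM_wave n l cr ci.
apply: (@cintegrable_le _ _ _ (fun x => C * 2 * weight x)) => //.
- by apply: measurable_funTS; exact: continuous_measurable_fun.
- by apply: measurable_funTS; exact: continuous_measurable_fun.
- exact: integrable_weightZ.
- move=> x Jx; apply: le_trans (cnorm1M _ _) _; rewrite mulrAC.
  by apply: ler_pM; rewrite ?cnorm1_ge0// cnorm1_wave// ltW.
Qed.

(** Integration by parts: the integral of phi against a wave is controlled by
    the inverse of the logarithmic derivative of the wave. *)
Lemma wave_coef_parts phi : m != 0 -> schwartz phi -> exists C, forall n l,
  Im l <= 0 ->
  cnorm1 (wave_rate n l) * cnorm1 (cintegral J (fun x => phi x * wave n l x)) <= C.
Proof.
move=> m0 sphi; have mJ := measurable_halfline k m0.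
have [sr si] := sphi.
have [C C0 [_ hC hD]] := schwartz_bound sphi.
have cr := rschwartz_continuous sr; have ci := rschwartz_continuous si.
have dcr := rschwartz_continuous_derive sr.
have dci := rschwartz_continuous_derive si.
exists (2 * (2 * C + 2 * (C * 2 * \int[mu]_(x in J) weight x))) => n l l0.
set c := wave_rate n l; set I := cintegral _ _.
have [c1 c2] := continuousM_wave n l cr ci.
have [d1 d2] := @continuousM_wave (cderive1 phi) n l dcr dci.
have iw := @cintegrable_wave phi n l C m0 cr ci hC l0.
have iD := @cintegrable_wave (cderive1 phi) n l C m0 dcr dci hD l0.
have bnd (f : R -> R[i]) : (forall x, cnorm1 (f x) <= C * weight x) ->
    forall x, 0 <= m * x - k -> cnorm1 (f x * wave n l x) <= C * 2 * weight x.
  move=> hf x x0; apply: le_trans (cnorm1M _ _) _; rewrite mulrAC.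
  by apply: ler_pM; rewrite ?cnorm1_ge0// cnorm1_wave.
(* G is the derivative of phi times the wave. *)
pose G x := cderive1 phi x * wave n l x + c * (phi x * wave n l x).
have GE : cintegral J G = cintegral J (fun x => cderive1 phi x * wave n l x) + c * I.
  by rewrite cintegralD// ?cintegralMl//; exact: cintegrableMl.
have GF : cnorm1 (cintegral J G) = cnorm1 (phi (k / m) * wave n l (k / m)).
  have cc (a b : R) (f g : R -> R) : continuous f -> continuous g ->
      continuous (fun x => a * f x + b * g x).
    move=> cf cg x; apply: cvgD; apply: cvgM; try exact: cvg_cst; [exact: cf|exact: cg].
  apply: (@cnorm1_cintegral_derive _ m k (fun x => phi x * wave n l x) G
    (C * 2 + cnorm1 c * (C * 2))) => //.
  - have -> : Re \o G = (fun x => (Re \o (fun x => cderive1 phi x * wave n l x)) x +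
        (Re c * (Re \o (fun x => phi x * wave n l x)) x +
        (- Im c) * (Im \o (fun x => phi x * wave n l x)) x)).
      by apply/funext => x; rewrite /comp /G cReD (cReM c); ring.
    by move=> x; apply: cvgD; [exact: d1|exact: cc].
  - have -> : Im \o G = (fun x => (Im \o (fun x => cderive1 phi x * wave n l x)) x +
        (Re c * (Im \o (fun x => phi x * wave n l x)) x +
        (Im c) * (Re \o (fun x => phi x * wave n l x)) x)).
      by apply/funext => x; rewrite /comp /G cImD (cImM c); ring.
    by move=> x; apply: cvgD; [exact: d2|exact: cc].
  - move=> x; have [w1 w2] := is_derive_wave n l x.
    have pr := rschwartz_is_derive sr x; have pi := rschwartz_is_derive si x.
    have h := is_deriveB (is_deriveM pr w1) (is_deriveM pi w2).
    have -> : Re \o (fun x => phi x * wave n l x) =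
      (fun x => Re (phi x)) * (Re \o wave n l) - (fun x => Im (phi x)) * (Im \o wave n l).
      by apply/funext => y; rewrite /= cReM.
    apply: (is_derive_eq h); rewrite /G /cderive1 /GRing.scale /= -/c.
    rewrite !cReD !(cReM, cImM) /=; ring.
  - move=> x; have [w1 w2] := is_derive_wave n l x.
    have pr := rschwartz_is_derive sr x; have pi := rschwartz_is_derive si x.
    have h := is_deriveD (is_deriveM pr w2) (is_deriveM pi w1).
    have -> : Im \o (fun x => phi x * wave n l x) =
      (fun x => Re (phi x)) * (Im \o wave n l) + (fun x => Im (phi x)) * (Re \o wave n l).
      by apply/funext => y; rewrite /= cImM.
    apply: (is_derive_eq h); rewrite /G /cderive1 /GRing.scale /= -/c.
    rewrite !cImD !(cReM, cImM) /=; ring.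
  - move=> x x0; apply: le_trans (bnd _ hC x x0) _.
    apply: ler_wpM2r; first exact/ltW/weight_gt0.
    by rewrite lerDl !mulr_ge0// cnorm1_ge0.
  - move=> x x0; apply: le_trans (cnorm1D _ _) _; rewrite mulrDl lerD ?bnd//.
    apply: le_trans (cnorm1M _ _) _.
    by rewrite -mulrA ler_wpM2l ?cnorm1_ge0// bnd.
apply: le_trans (cnorm1M_ge _ _) _; rewrite ler_wpM2l//.
have -> : c * I = cintegral J G - cintegral J (fun x => cderive1 phi x * wave n l x).
  by rewrite GE; ring.
apply: le_trans (cnorm1B _ _) _; rewrite lerD//.
  rewrite GF; apply: le_trans (bnd _ hC _ _) _.
    by rewrite mulrC divfK// subrr.
  by have := weight_le1 (k / m); have := weight_gt0 (k / m); nra.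
rewrite -RintegralZl//; last exact: integrable_weight.
apply: cnorm1_cintegral_le => //; first exact: integrable_weightZ.
by move=> x Jx; apply: bnd => //; exact: ltW.
Qed.

End Wave.

(** * Coefficients of the waves *)

Section Coefficients.
Variables (R : realType) (m k : R) (phi : R -> R[i]).
Hypotheses (m0 : m != 0) (sphi : schwartz phi).
Implicit Types (n : int) (l : R[i]).
Local Notation Re := (@complex.Re R).
Local Notation Im := (@complex.Im R).
Local Notation mu := (@lebesgue_measure R).
Local Notation J := (halfline m k).

(** The integral of phi against a wave over the half-line; for l = n ^ 2 / 2 it
    is the n-th term of the pairing of v with phi. *)
Definition wave_coef n l : R[i] :=
  cintegral J (fun x => phi x * wave m k n l x).

Lemma cintegrable_wave_coef n l : Im l <= 0 ->
  cintegrable J (fun x => phi x * wave m k n l x).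
Proof.
move=> l0; have [C _ [_ hC _]] := schwartz_bound sphi; have [sr si] := sphi.
exact: (@cintegrable_wave _ m k phi n l C m0 (rschwartz_continuous sr)
  (rschwartz_continuous si) hC l0).
Qed.

Lemma wave_coef_le : exists2 B, 0 <= B &
  forall n l, Im l <= 0 -> cnorm1 (wave_coef n l) <= B.
Proof.
have mJ := measurable_halfline k m0.
have [C C0 [_ hC _]] := schwartz_bound sphi.
exists (2 * (C * 2 * \int[mu]_(x in J) weight x)).
  rewrite !mulr_ge0// Rintegral_ge0// => x _; exact/ltW/weight_gt0.
move=> n l l0; rewrite -RintegralZl//; last exact: integrable_weight.
apply: cnorm1_cintegral_le => //.
- exact: cintegrable_wave_coef.
- exact: integrable_weightZ.
- move=> x Jx; apply: le_trans (cnorm1M _ _) _; rewrite mulrAC.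
  by apply: ler_pM; rewrite ?cnorm1_ge0// cnorm1_wave// ltW.
Qed.

Lemma cnorm1_wave_rate_ge n l :
  `|m| * cnorm1 l - `|n%:~R| <= cnorm1 (wave_rate m n l).
Proof.
rewrite /cnorm1 /wave_rate /= !normrM mulrDr.
have p2 : (1 : R) <= `|2| * `|pi|.
  by rewrite !ger0_norm ?pi_ge0//; have := pi_ge2 R; lra.
have := ler_normB (n%:~R - m * Re l) n%:~R.
have -> : n%:~R - m * Re l - n%:~R = - (m * Re l) by ring.
rewrite normrN normrM.
have := mulr_ge0 (normr_ge0 m) (normr_ge0 (Im l)).
have := normr_ge0 (n%:~R - m * Re l).
move: p2 (`|n%:~R - m * Re l|) (`|m|) (`|Re l|) (`|Im l|).
move: (`|2| * `|pi|) (`|n%:~R|) => p a p1 b c d e b0 ce h.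
rewrite -mulrA; have := ler_wpM2r b0 p1; have := ler_wpM2r ce p1; lra.
Qed.

(** A bound uniform over all dispersions at least as large as a multiple of
    n ^ 2, as those of the propagating modes of w_r are for every r. *)
Lemma wave_coef_bound : exists2 D, 0 <= D &
  forall n l, Im l <= 0 -> n%:~R ^+ 2 / 4 <= cnorm1 l ->
    cnorm1 (wave_coef n l) <= D / (1 + n%:~R ^+ 2).
Proof.
have [C hC] := wave_coef_parts k m0 sphi.
have [B B0 hB] := wave_coef_le.
have mp : 0 < `|m| by rewrite normr_gt0.
exists (16 * `|C| / `|m| + B * (1 + 64 / `|m| ^+ 2)).
  by rewrite addr_ge0// mulr_ge0// ?invr_ge0 ?mulr_ge0// addr_ge0// divr_ge0.
move=> n l l0 nl; rewrite ler_pdivlMr ?oneDsqr_gt0//.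
have T1 : 0 <= 16 * `|C| / `|m| by rewrite divr_ge0// mulr_ge0.
have T2 : 0 <= B * (1 + 64 / `|m| ^+ 2) by rewrite mulr_ge0// addr_ge0// divr_ge0.
have nn : n%:~R ^+ 2 = `|n%:~R| ^+ 2 :> R by rewrite real_normK ?num_real.
rewrite nn in nl *.
(* For large n the phase has no stationary point and integration by parts gives
   the decay; the finitely many other n are absorbed in the constant. *)
have [big|small] := leP 8 (`|m| * `|n%:~R|).
  have := hC n l l0; rewrite -/(wave_coef n l).
  have := cnorm1_wave_rate_ge n l; have := cnorm1_ge0 (wave_coef n l).
  have n1 : (1 : R) <= `|n%:~R|.
    rewrite -intr_norm -[1]/(1%:~R) ler_int -gtz0_ge1 normr_gt0.
    by apply: contraTneq big => ->; rewrite normr0 mulr0 -ltNge.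
  move: (cnorm1 (wave_coef n l)) (cnorm1 (wave_rate m n l)) => I c I0 hc hI.
  have hc' : `|m| * `|n%:~R| ^+ 2 / 8 <= c.
    have : `|m| * (`|n%:~R| ^+ 2 / 4) <= `|m| * cnorm1 l by rewrite ler_wpM2l// ltW.
    have : 8 * `|n%:~R| <= `|m| * `|n%:~R| * `|n%:~R| by rewrite ler_wpM2r.
    rewrite expr2; lra.
  have hI' : `|m| * `|n%:~R| ^+ 2 / 8 * I <= `|C|.
    by apply: le_trans (ler_norm C); apply: le_trans hI; rewrite ler_wpM2r.
  suff : I * (1 + `|n%:~R| ^+ 2) <= 16 * `|C| / `|m| by lra.
  rewrite ler_pdivlMr//.
  have : 1 <= `|n%:~R| ^+ 2 :> R by rewrite expr_ge1.
  move: (`|n%:~R| ^+ 2) hI' => N hI' N1.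
  have : `|m| * I * 1 <= `|m| * I * N by rewrite ler_wpM2l// mulr_ge0// ltW.
  lra.
have := hB n l l0; have := cnorm1_ge0 (wave_coef n l).
move: (cnorm1 (wave_coef n l)) => I I0 IB.
suff : I * (1 + `|n%:~R| ^+ 2) <= B * (1 + 64 / `|m| ^+ 2) by lra.
apply: ler_pM => //.
rewrite lerD2l ler_pdivlMr ?exprn_gt0// mulrC -exprMn.
have -> : 64 = 8 ^+ 2 :> R by ring.
by rewrite lerXn2r ?nnegrE// ?mulr_ge0// ltW.
Qed.

Lemma lipschitz1 (f g : R -> R) : (forall x : R, is_derive x 1 f (g x)) ->
  (forall x, `|g x| <= 1) -> forall a b, `|f a - f b| <= `|a - b|.
Proof.
move=> df g1.
have cf : continuous f.
  by move=> x; apply/differentiable_continuous/derivable1_diffP; exact: ex_derive.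
have step a b : a <= b -> `|f b - f a| <= `|b - a|.
  move=> ab; have [c _ ->] := MVT_segment ab (fun y _ => df y) (continuous_subspaceT cf).
  by rewrite normrM ler_piMl.
move=> a b; have [ab|/ltW ab] := leP a b; last exact: step.
by rewrite distrC (distrC a); exact: step.
Qed.

(** For real dispersions the coefficients are Lipschitz in the dispersion. *)
Lemma wave_coef_lipschitz : exists2 K, 0 <= K & forall n (a b : R),
  cnorm1 (wave_coef n a%:C - wave_coef n b%:C) <= K * `|a - b|.
Proof.
have mJ := measurable_halfline k m0.
have [C C0 [hC _ _]] := schwartz_bound sphi.
set M := `|m| + `|k|; have M0 : 0 <= M by rewrite addr_ge0.
exists (2 * (4 * pi * M * C * \int[mu]_(x in J) weight x)).
  rewrite !mulr_ge0 ?pi_ge0// Rintegral_ge0// => x _; exact/ltW/weight_gt0.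
move=> n a b.
have ia : cintegrable J (fun x => phi x * wave m k n a%:C x).
  exact: cintegrable_wave_coef.
have ib : cintegrable J (fun x => phi x * wave m k n b%:C x).
  exact: cintegrable_wave_coef.
have -> : wave_coef n a%:C - wave_coef n b%:C =
    cintegral J (fun x => phi x * wave m k n a%:C x + (-1) * (phi x * wave m k n b%:C x)).
  by rewrite cintegralD ?cintegralMl ?mulN1r//; exact: cintegrableMl.
apply: (@le_trans _ _ (2 * \int[mu]_(x in J)
    (4 * pi * M * C * `|a - b| * weight x))); last first.
  by rewrite RintegralZl//; [lra|exact: integrable_weight].
apply: cnorm1_cintegral_le => //.
- by apply: cintegrableD => //; exact: cintegrableMl.
- exact: integrable_weightZ.
move=> x Jx.
have -> : phi x * wave m k n a%:C x + -1 * (phi x * wave m k n b%:C x) =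
    phi x * (wave m k n a%:C x - wave m k n b%:C x) by ring.
apply: le_trans (cnorm1M _ _) _.
have hs : `|m * x - k| <= M * (1 + `|x|).
  apply: le_trans (ler_normB _ _) _; rewrite normrM /M.
  have := mulr_ge0 (normr_ge0 k) (normr_ge0 x); have := normr_ge0 m; lra.
have hw : cnorm1 (wave m k n a%:C x - wave m k n b%:C x) <=
    4 * pi * `|a - b| * `|m * x - k|.
  rewrite /cnorm1 cReD cImD cReN cImN /wave /cexp /= !mulr0 mul0r expR0 !mul1r.
  have lc := lipschitz1 (fun y => is_derive_cos y)
    (fun y => eq_ind_r (fun z => z <= 1) (sin_max y) (normrN (sin y))).
  have ls := lipschitz1 (fun y => is_derive_sin y) (fun y => cos_max y).
  set u := 2 * pi * _; set v := 2 * pi * _.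
  have -> : 4 * pi * `|a - b| * `|m * x - k| = 2 * `|u - v|.
    have -> : u - v = - (2 * pi * ((a - b) * (m * x - k))) by rewrite /u /v; ring.
    rewrite normrN !normrM (ger0_norm (pi_ge0 R)) ger0_norm//; ring.
  by have := lc u v; have := ls u v; lra.
have := ler_pM (cnorm1_ge0 _) (cnorm1_ge0 _) (lexx (cnorm1 (phi x))) hw.
move=> /le_trans; apply.
have -> : cnorm1 (phi x) * (4 * pi * `|a - b| * `|m * x - k|) =
   (4 * pi * `|a - b|) * (cnorm1 (phi x) * `|m * x - k|) by ring.
have -> : 4 * pi * M * C * `|a - b| * weight x =
   (4 * pi * `|a - b|) * (M * (C * weight x)) by ring.
apply: ler_wpM2l; first by rewrite !mulr_ge0// pi_ge0.
apply: le_trans (ler_wpM2l M0 (hC x)).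
have -> : M * ((1 + `|x|) * cnorm1 (phi x)) = cnorm1 (phi x) * (M * (1 + `|x|)) by ring.
by apply: ler_wpM2l hs; exact: cnorm1_ge0.
Qed.

End Coefficients.

(** * The dispersion relation of w_r *)

Section Dispersion.
Variable R : realType.
Implicit Types (r : R) (n : int).
Local Notation Re := (@complex.Re R).
Local Notation Im := (@complex.Im R).

(** The dispersion of the wave of frequency n in the series defining w_r; it is
    real for |n| <= r, and tends to n ^ 2 / 2 as r tends to infinity. *)
Definition dispersion r n : R[i] :=
  (r ^+ 2)%:C * (1 - csqrt (1 - (n%:~R / r) ^+ 2)).

(** The value of the dispersion for |n| <= r. *)
Definition real_dispersion r n : R :=
  r ^+ 2 * (1 - Num.sqrt (1 - (n%:~R / r) ^+ 2)).

Lemma dispersion_propagating r n : 0 < r -> `|n%:~R| <= r ->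
  dispersion r n = (real_dispersion r n)%:C.
Proof.
move=> r0 nr; rewrite /dispersion /csqrt ifT.
  by apply: complexP => /=; rewrite !(mul0r, mulr0, subr0, oppr0, addr0).
rewrite subr_ge0 -[X in X <= _]real_normK ?num_real// expr_le1//.
by rewrite normrM normfV (gtr0_norm r0) ler_pdivrMr// mul1r.
Qed.

(** With y = sqrt (1 - (n / r) ^ 2), the dispersion is n ^ 2 / (1 + y). *)
Lemma real_dispersion_bound r n : 0 < r -> `|n%:~R| <= r ->
  n%:~R ^+ 2 / 2 <= real_dispersion r n /\
  `|real_dispersion r n - n%:~R ^+ 2 / 2| <= n%:~R ^+ 4 / r ^+ 2.
Proof.
move=> r0 nr; rewrite /real_dispersion; set y := Num.sqrt _.
have q0 : 0 <= 1 - (n%:~R / r) ^+ 2.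
  rewrite subr_ge0 -[X in X <= _]real_normK ?num_real// expr_le1//.
  by rewrite normrM normfV (gtr0_norm r0) ler_pdivrMr// mul1r.
have y0 : 0 <= y by exact: sqrtr_ge0.
have yE : y ^+ 2 = 1 - (n%:~R / r) ^+ 2 by rewrite sqr_sqrtr.
have y1 : y <= 1.
  rewrite -(expr_le1 (n := 2))// yE; have := sqr_ge0 (n%:~R / r); lra.
set a := r ^+ 2 * (1 - y).
have aE : a * (1 + y) = n%:~R ^+ 2.
  have -> : a * (1 + y) = r ^+ 2 * (1 - y ^+ 2) by rewrite /a; ring.
  by rewrite yE; field; rewrite gt_eqF.
have a0 : 0 <= a by rewrite mulr_ge0 ?sqr_ge0// subr_ge0.
have an : n%:~R ^+ 2 / 2 <= a by rewrite -aE; nra.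
split=> //.
rewrite ger0_norm ?subr_ge0// ler_pdivlMr ?exprn_gt0//.
have -> : (a - n%:~R ^+ 2 / 2) * r ^+ 2 = a ^+ 2 / 2.
  by rewrite -aE /a; field.
have -> : n%:~R ^+ 4 = (n%:~R ^+ 2) ^+ 2 :> R by rewrite -exprM.
rewrite -aE; nra.
Qed.

Lemma dispersion_evanescent r n : 0 < r -> r < `|n%:~R| ->
  dispersion r n = (r ^+ 2) -i* (r ^+ 2 * Num.sqrt ((n%:~R / r) ^+ 2 - 1)).
Proof.
move=> r0 nr; rewrite /dispersion /csqrt ifF.
  rewrite opprB; apply: complexP => /=;
    by rewrite ?(mul0r, mulr0, subr0, oppr0, addr0, mul1r, mulr1, add0r, sub0r) ?mulrN.
apply/negbTE; rewrite -ltNge subr_lt0 -[X in _ < X]real_normK ?num_real//.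
by rewrite exprn_egt1// normrM normfV (gtr0_norm r0) ltr_pdivlMr// mul1r.
Qed.

Lemma dispersion_Im_le0 r n : 0 < r -> Im (dispersion r n) <= 0.
Proof.
move=> r0; have [nr|nr] := leP `|n%:~R| r.
  by rewrite dispersion_propagating.
rewrite dispersion_evanescent//= oppr_le0 mulr_ge0 ?sqr_ge0//; exact: sqrtr_ge0.
Qed.

(** The lower bound also covers the first evanescent modes, r < |n| <= r + 1. *)
Lemma dispersion_ge r n : 1 <= r -> `|n%:~R| <= r + 1 ->
  n%:~R ^+ 2 / 4 <= cnorm1 (dispersion r n).
Proof.
move=> r1 nr1; have r0 : 0 < r by apply: lt_le_trans r1.
have [nr|nr] := leP `|n%:~R| r.
  rewrite dispersion_propagating// cnorm1_real.
  apply: le_trans (ler_norm _); have [h _] := real_dispersion_bound r0 nr.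
  by apply: le_trans h; have := sqr_ge0 (n%:~R : R); lra.
apply: le_trans (cnorm1_Re _); rewrite dispersion_evanescent//=.
apply: le_trans (ler_norm _).
rewrite -[X in X / 4]real_normK ?num_real//.
have := normr_ge0 (n%:~R : R); nra.
Qed.

End Dispersion.

(** * Splitting of w_r *)

Section Splitting.
Variable R : realType.
Implicit Types (r s x m k : R) (n : int).
Local Notation Re := (@complex.Re R).
Local Notation Im := (@complex.Im R).
Local Notation mu := (@lebesgue_measure R).

Lemma Re_zpair (u : int -> R[i]) (j : nat) :
  Re (zpair u j) = zpair (fun n => Re (u n)) j.
Proof. by rewrite /zpair; case: eqP => // _; rewrite cReD. Qed.

Lemma Im_zpair (u : int -> R[i]) (j : nat) :
  Im (zpair u j) = zpair (fun n => Im (u n)) j.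
Proof. by rewrite /zpair; case: eqP => // _; rewrite cImD. Qed.

Lemma zpairMl (c : R[i]) (u : int -> R[i]) (j : nat) :
  c * zpair u j = zpair (fun n => c * u n) j.
Proof. by rewrite /zpair; case: eqP => // _; rewrite mulrDr. Qed.

Lemma zsumR_split (u : int -> R) (N : nat) (t : R) :
  \sum_(0 <= j < M) zpair u (N.+1 + j) @[M --> \oo] --> t ->
  zsumR u = \sum_(0 <= n < N.+1) zpair u n + t.
Proof.
move=> ut; rewrite /zsumR; apply: cvg_lim => //.
rewrite (_ : (fun _ => _) = (fun N' => \sum_(0 <= n < N'.+1) zpair u n)); last first.
  by apply/funext => N'; rewrite sum_zpair.
rewrite -(cvg_shiftn N).
rewrite (_ : (fun _ => _) = (fun M => \sum_(0 <= n < N.+1) zpair u n +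
   \sum_(0 <= j < M) zpair u (N.+1 + j))).
  by apply: cvgD => //; exact: cvg_cst.
apply/funext => M.
rewrite (@big_cat_nat _ _ _ N.+1)//=; last by rewrite ltnS leq_addl.
congr (_ + _); rewrite -{1}(add0n N.+1) big_addn subSS addnK.
by apply: eq_bigr => j _; rewrite addnC.
Qed.

(** The factor depending on the height s in the n-th term of the series defining
    w_r; the common phase exp (- 2 pi i r ^ 2 s) is not included. *)
Definition mode r n s : R[i] :=
  cexp ('i%C * (2 * pi * r ^+ 2)%:C * csqrt (1 - (n%:~R / r) ^+ 2) * s%:C).

Lemma mode_wave m k r n x :
  cexp (- 'i%C * (2 * pi * r ^+ 2 * (m * x - k))%:C) *
    (mode r n (m * x - k) * cexp ('i%C * (2 * pi * n%:~R * x)%:C)) =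
  wave m k n (dispersion r n) x.
Proof.
rewrite /mode /wave -!cexpD /dispersion; congr cexp.
by case: (csqrt _) => a b; apply: complexP => /=; ring.
Qed.

(** The exponential rate at which the mode of frequency n > r decays with the
    height. *)
Definition decay_rate r (n : nat) : R :=
  2 * pi * (r ^+ 2 * Num.sqrt ((n%:R / r) ^+ 2 - 1)).

Lemma mode_evanescent r (n : nat) s : 0 < r -> r < n%:R ->
  mode r n%:Z s = (expR (- (decay_rate r n * s)))%:C.
Proof.
move=> r0 nr; rewrite /mode /csqrt -pmulrn ifF.
  rewrite opprB /decay_rate; set y := Num.sqrt _.
  have -> : 'i%C * (2 * pi * r ^+ 2)%:C * ('i%C * y%:C) * s%:C =
      (- (2 * pi * (r ^+ 2 * y) * s))%:C :> R[i].
    by apply: complexP => /=; ring.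
  by rewrite /cexp /= cos0 sin0 mulr1 mulr0.
apply/negbTE; rewrite -ltNge subr_lt0 exprn_egt1 ?divr_ge0 ?(ltW r0)//.
by rewrite ltr_pdivlMr// mul1r.
Qed.

Lemma modeN r n s : mode r (- n) s = mode r n s.
Proof. by rewrite /mode rmorphN/= mulNr sqrrN. Qed.

Lemma le_decay_rate r (i j : nat) : 0 < r -> (i <= j)%N ->
  decay_rate r i <= decay_rate r j.
Proof.
move=> r0 ij; rewrite /decay_rate ler_wpM2l ?mulr_ge0 ?pi_ge0// ler_wpM2l ?sqr_ge0//.
apply: ler_wsqrtr; rewrite lerD2r lerXn2r ?nnegrE ?divr_ge0 ?(ltW r0)//.
by rewrite ler_wpM2r ?invr_ge0 ?(ltW r0)// ler_nat.
Qed.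

Lemma decay_rate_ge r (n : nat) : 0 < r -> r < n%:R ->
  2 * pi * r * (n%:R - r) <= decay_rate r n.
Proof.
move=> r0 nr; rewrite /decay_rate -mulrA ler_wpM2l ?mulr_ge0 ?pi_ge0//.
rewrite expr2 -mulrA ler_wpM2l ?(ltW r0)//.
have t1 : 0 <= n%:R / r - 1 by rewrite subr_ge0 ler_pdivlMr// mul1r ltW.
have -> : n%:R - r = r * (n%:R / r - 1) by field; rewrite gt_eqF.
rewrite ler_wpM2l ?(ltW r0)// -[leLHS]ger0_norm// -sqrtr_sqr ler_wsqrtr//; nra.
Qed.

(** The least natural number greater than r, for r > 0.  The modes of index
    +- cutoff r are evanescent, but their decay rate may be arbitrarily small; they
    are therefore grouped with the propagating ones. *)
Definition cutoff r : nat := (Num.truncn r).+1.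

Lemma cutoff_gt r : 0 < r -> r < (cutoff r)%:R.
Proof. by move=> r0; have := truncn_itv (ltW r0) => /andP[]. Qed.

Lemma cutoff_le r : 0 < r -> (cutoff r)%:R <= r + 1.
Proof.
by move=> r0; have := truncn_itv (ltW r0) => /andP[h _]; rewrite /cutoff -natr1 lerD2r.
Qed.

(** The terms of index n and - n, for n = cutoff r + 1 + j, added up. *)
Definition tail_term r x s (j : nat) : R :=
  2 * cos (2 * pi * ((cutoff r).+1 + j)%:R * x) *
    expR (- (decay_rate r ((cutoff r).+1 + j) * s)).

(** The sum of the evanescent modes of index greater than cutoff r, without
    their common phase; it is real. *)
Definition tail r x s : R := limn (series (tail_term r x s)).

Lemma decay_rate_tail r (j : nat) : 0 < r ->
  2 * pi * r * j.+1%:R <= decay_rate r ((cutoff r).+1 + j).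
Proof.
move=> r0; have cg := cutoff_gt r0.
have h : r + j.+1%:R <= ((cutoff r).+1 + j)%:R.
  by rewrite addSnnS natrD lerD2r ltW.
apply: le_trans (decay_rate_ge r0 _).
  by rewrite ler_wpM2l ?mulr_ge0 ?pi_ge0 ?(ltW r0)//; lra.
by apply: lt_le_trans h; rewrite ltrDl.
Qed.

Lemma tail_term_le r x s (j : nat) : 0 < r -> 0 < s ->
  `|tail_term r x s j| <= 2 * expR (- (2 * pi * r * s * j.+1%:R)).
Proof.
move=> r0 s0; rewrite /tail_term !normrM (ger0_norm (expR_ge0 _)) ger0_norm//.
rewrite -mulrA ler_wpM2l// -[leRHS]mul1r.
apply: ler_pM => //; rewrite ?expR_ge0//; first exact: cos_max.
rewrite ler_expR lerN2 mulrAC ler_wpM2r ?(ltW s0)//; exact: decay_rate_tail.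
Qed.

Lemma sum_tail_term_le r x s (M : nat) : 0 < r -> 0 < s ->
  `|\sum_(0 <= j < M) tail_term r x s j| <= 2 * (2 * pi * r * s)^-1.
Proof.
move=> r0 s0; have t0 : 0 < 2 * pi * r * s by rewrite !mulr_gt0// pi_gt0.
apply: le_trans (ler_norm_sum _ _ _) _.
apply: le_trans (ler_sum _ (fun j _ => tail_term_le x j r0 s0)) _.
by rewrite -mulr_sumr ler_wpM2l// geometric_expR_bound.
Qed.

Lemma cvg_tail r x s : 0 < r -> 0 < s ->
  \sum_(0 <= j < M) tail_term r x s j @[M --> \oo] --> tail r x s.
Proof.
move=> r0 s0; have t0 : 0 < 2 * pi * r * s by rewrite !mulr_gt0// pi_gt0.
suff : cvgn (series (tail_term r x s)) by [].
apply: normed_cvg.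
apply: (@series_le_cvg _ _ (fun j => 2 * expR (- (2 * pi * r * s * j.+1%:R)))).
- by move=> j; exact: normr_ge0.
- by move=> j; rewrite mulr_ge0// expR_ge0.
- by move=> j; exact: tail_term_le.
apply: nondecreasing_is_cvgn.
  apply/nondecreasing_seqP => n; rewrite /series/= big_nat_recr//= lerDl.
  by rewrite mulr_ge0// expR_ge0.
exists (2 * (2 * pi * r * s)^-1) => _ [n _ <-].
by rewrite /series/= -mulr_sumr ler_wpM2l// geometric_expR_bound.
Qed.

Lemma norm_cvg_le (u : nat -> R) (l C : R) :
  u @ \oo --> l -> (forall j, `|u j| <= C) -> `|l| <= C.
Proof.
move=> /cvg_norm ul uC; rewrite -(cvg_lim _ ul)//; apply: limr_le.
  by apply/cvg_ex; exists `|l|.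
by apply: nearW => j; exact: uC.
Qed.

(** The tail is bounded by a geometric series. *)
Lemma tail_le r x s : 0 < r -> 0 < s -> `|tail r x s| <= (pi * r * s)^-1.
Proof.
move=> r0 s0; have -> : (pi * r * s)^-1 = 2 * (2 * pi * r * s)^-1.
  by move: (@pi R) (pi_gt0 R) => p p0; field; rewrite !gt_eqF.
by apply: (norm_cvg_le (@cvg_tail r x s r0 s0)) => M; exact: sum_tail_term_le.
Qed.

(** By summation by parts, the tail stays bounded as the height s tends to 0
    away from the integers. *)
Lemma sin_tail_le r x s : 0 < r -> 0 < s -> `|sin (pi * x)| * `|tail r x s| <= 2.
Proof.
move=> r0 s0; rewrite -normrM.
have ct : sin (pi * x) * \sum_(0 <= j < M) tail_term r x s j @[M --> \oo] -->
    sin (pi * x) * tail r x s.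
  by apply: cvgM; [exact: cvg_cst|exact: cvg_tail].
apply: (norm_cvg_le ct) => M.
apply: le_trans (abel_cos_bound x (cutoff r).+1 M _ _) _.
- by move=> j; exact: expR_ge0.
- move=> j; rewrite ler_expR lerN2 ler_wpM2r ?(ltW s0)//.
  by apply: le_decay_rate => //; rewrite addnS.
- rewrite ger_pMr// addn0 -expR0 ler_expR oppr_le0 mulr_ge0 ?(ltW s0)//.
  apply: mulr_ge0; first by rewrite mulr_ge0 ?pi_ge0.
  by rewrite mulr_ge0 ?sqr_ge0 ?sqrtr_ge0.
Qed.

Lemma zpair_mode_tail r x s (j : nat) : 0 < r ->
  zpair (fun n => mode r n s * cexp ('i%C * (2 * pi * n%:~R * x)%:C))
    ((cutoff r).+1 + j) = (tail_term r x s j)%:C.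
Proof.
move=> r0; rewrite /zpair addSn /= modeN mode_evanescent//; last first.
  by apply: lt_le_trans (cutoff_gt r0) _; rewrite ler_nat leqW// leq_addr.
rewrite rmorphN/= -pmulrn /tail_term addSn.
set e := expR _; set y := _.+1%:R.
by apply: complexP; rewrite /= !(mul0r, mulr0, subr0, addr0, oppr0, add0r, mul1r,
  expR0, mulrN, mulNr, cosN, sinN, addrN); ring.
Qed.

(** w_r is a finite sum of waves, with indices at most cutoff r, and a tail. *)
Lemma w_split m k r x : 0 < r -> halfline m k x ->
  w r x (m * x - k) =
  \sum_(0 <= n < (cutoff r).+1) zpair (fun n => wave m k n (dispersion r n) x) n +
  cexp (- 'i%C * (2 * pi * r ^+ 2 * (m * x - k))%:C) * (tail r x (m * x - k))%:C.
Proof.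
move=> r0 s0; have s0' : 0 < m * x - k := s0.
rewrite /w (gtr0_norm s0').
set u := fun n : int => _ * cexp ('i%C * (2 * pi * n%:~R * x)%:C).
set A := cexp (- _ * _).
have -> : (fun n => wave m k n (dispersion r n) x) = (fun n => A * u n).
  by apply/funext => n; rewrite -mode_wave.
under eq_bigr do rewrite -zpairMl.
rewrite -mulr_sumr -mulrDr; congr (_ * _).
have ut j : zpair u ((cutoff r).+1 + j) = (tail_term r x (m * x - k) j)%:C.
  exact: zpair_mode_tail.
apply: complexP; rewrite cReD || rewrite cImD.
- rewrite cRe_sum; under eq_bigr do rewrite Re_zpair.
  apply: zsumR_split.
  under eq_fun do (under eq_bigr do rewrite -Re_zpair ut /=).
  exact: cvg_tail.
- rewrite cIm_sum; under eq_bigr do rewrite Im_zpair.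
  apply: zsumR_split.
  under eq_fun do (under eq_bigr do rewrite -Im_zpair ut /=).
  by under eq_fun do rewrite big1//; exact: cvg_cst.
Qed.

Lemma measurable_tail m k r : m != 0 -> 0 < r ->
  measurable_fun (halfline m k : set (measurableTypeR R))
    (fun x => tail r x (m * x - k)).
Proof.
move=> m0 r0.
apply: (@measurable_fun_cvg _ (measurableTypeR R) R _
  (fun M x => \sum_(0 <= j < M) tail_term r x (m * x - k) j)); last first.
  by move=> x Jx; exact: cvg_tail.
move=> M; apply: measurable_sum => j; apply: measurable_funTS.
apply: continuous_measurable_fun => x; apply: cvgM.
  apply: cvgM; first exact: cvg_cst.
  apply: continuous_comp; last exact: continuous_cos.
  exact: mulrl_continuous.
apply: continuous_comp; last exact: continuous_expR.
apply: cvgN; apply: cvgM; first exact: cvg_cst.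
by apply: cvgB; [exact: mulrl_continuous|exact: cvg_cst].
Qed.

End Splitting.

(** * The remainder *)

Section Remainder.
Variables (R : realType) (m k : R) (phi : R -> R[i]).
Hypotheses (m0 : m != 0) (sphi : schwartz phi).
Hypothesis hk : k / m \is a Num.int -> phi (k / m) = 0.
Local Notation Re := (@complex.Re R).
Local Notation Im := (@complex.Im R).
Local Notation mu := (@lebesgue_measure R).
Local Notation J := (halfline m k).

Lemma sin_pi_neq0 (x : R) : x \isn't a Num.int -> sin (pi * x) != 0.
Proof.
have nat_case (b : R) (n : nat) : `|sin (b + pi * n%:R)| = `|sin b|.
  elim: n => [|n IH]; first by rewrite mulr0 addr0.
  by rewrite -natr1 mulrDr mulr1 addrA sinDpi normrN.
rewrite intrEfloor; set z := Num.floor x => zx.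
have /andP[zl zr] := floor_itv x; rewrite -/z in zl zr.
have zl' : z%:~R < x by rewrite lt_neqAle zx.
rewrite intrD in zr.
have sp : 0 < sin (pi * (x - z%:~R)).
  apply: sin_gt0_pi; rewrite mulr_gt0 ?pi_gt0 ?subr_gt0//=.
  by rewrite gtr_pMr ?pi_gt0//; lra.
rewrite -normr_gt0; move: sp {zx zl zr zl'}; case: z => n sp.
  have -> : pi * x = pi * (x - n%:~R) + pi * n%:R by rewrite -pmulrn; ring.
  by rewrite nat_case gtr0_norm.
rewrite -(nat_case _ n.+1).
have -> : pi * x + pi * n.+1%:R = pi * (x - (Negz n)%:~R).
  by rewrite NegzE rmorphN/= -pmulrn; ring.
by rewrite gtr0_norm.
Qed.

(** The neighbourhood of half-width eta of the point where the line meets the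
    axis. *)
Definition window (eta : R) : set R := `](k / m - eta), (k / m + eta)[%classic.

Lemma in_window eta x : `|x - k / m| < eta -> \1_(window eta) x = 1 :> R.
Proof.
move=> h; rewrite indicE mem_set// /window /= in_itv/=.
by move: h; rewrite ltr_norml => /andP[h1 h2]; apply/andP; split; lra.
Qed.

(** The tail times phi is of order 1 / r away from the singularity k / m and
    bounded near it: if k / m is an integer because phi vanishes there, if not
    because sin (pi x) does not. *)
Lemma tail_phi_bound : exists2 C, 0 <= C & forall r eta x, 0 < r ->
  0 < eta -> eta <= 1 -> J x ->
  `|tail r x (m * x - k)| * cnorm1 (phi x) <=
    C * \1_(window eta) x + C / (r * eta) * weight x.
Proof.
have mp : 0 < `|m| by rewrite normr_gt0.
have sE x : J x -> m * x - k = `|m| * `|x - k / m|.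
  move=> Jx; rewrite -normrM mulrBr [m * (k / m)]mulrC divfK// gtr0_norm//.
have tl r x : 0 < r -> J x -> `|tail r x (m * x - k)| * (r * (`|m| * `|x - k / m|)) <= 1.
  move=> r0 Jx; have Jx' : 0 < m * x - k := Jx.
  have := tail_le x r0 Jx'.
  rewrite -ler_pdivlMr ?mul1r; last by rewrite mulr_gt0// -sE.
  move=> /le_trans; apply; rewrite -sE// lef_pV2 ?posrE ?mulr_gt0 ?pi_gt0//.
  have := pi_ge2 R; have : 0 < r * (m * x - k) by rewrite mulr_gt0.
  rewrite -mulrA; nra.
have ind0 eta x : 0 <= \1_(window eta) x :> R by rewrite indicE.
have wp x := weight_gt0 (x : R).
have [C C0 [_ hC _]] := schwartz_bound sphi.
have [xi|xni] := boolP (k / m \is a Num.int).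
  have [D D0 hD] := schwartz_vanish sphi (hk xi).
  exists (D / `|m|); first by rewrite divr_ge0.
  move=> r eta x r0 e0 e1 Jx.
  apply: (@le_trans _ _ (D / `|m| / (r * eta) * weight x)); last first.
    by rewrite lerDr mulr_ge0// divr_ge0.
  have h1 := tl r x r0 Jx; have h2 := hD x; have w0 := wp x.
  have d0 := normr_ge0 (x - k / m); have t0 := normr_ge0 (tail r x (m * x - k)).
  move: (`|tail _ _ _|) (`|x - k / m|) (cnorm1 _) (cnorm1_ge0 (phi x)) (weight x)
    (`|m|) mp t0 d0 w0 h1 h2 => t d p p0 w M M0 t0 d0 w0 h1 h2.
  have -> : D / M / (r * eta) * w = D * w / (r * eta * M).
    by field; rewrite !gt_eqF.
  rewrite ler_pdivlMr ?mulr_gt0// mulrA.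
  have : t * p * (r * eta) * M <= t * (D * d * w) * (r * 1) * M.
    apply: ler_wpM2r; first exact: ltW.
    apply: ler_pM; rewrite ?mulr_ge0 ?(ltW r0) ?(ltW e0)//.
      by rewrite ler_wpM2l.
    by rewrite ler_wpM2l// ltW.
  move=> /le_trans; apply.
  have -> : t * (D * d * w) * (r * 1) * M = D * w * (t * (r * (M * d))) by ring.
  by rewrite -[leRHS]mulr1 ler_wpM2l// mulr_ge0// ltW.
have s0 := sin_pi_neq0 xni.
(* On a ball of radius d <= 1 around k / m, |sin (pi x)| is at least c. *)
set c := `|sin (pi * (k / m))| / 2.
have c0 : 0 < c by rewrite divr_gt0// normr_gt0.
have [d [d0 d1 hd]] : exists d : R, [/\ 0 < d, d <= 1 &
    forall x, `|x - k / m| < d -> c <= `|sin (pi * x)|].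
  have cs : (fun x : R => `|sin (pi * x)|) @ (k / m) --> `|sin (pi * (k / m))|.
    apply: cvg_norm; apply: continuous_comp; last exact: continuous_sin.
    exact: mulrl_continuous.
  have c2 : c < `|sin (pi * (k / m))| by rewrite /c ltr_pdivrMr// ltr_pMr ?normr_gt0//; lra.
  have hn : \forall x \near k / m, c <= `|sin (pi * x)| by exact: cvgr_ge cs _ c2.
  have [d /= d0 hd] : exists2 d : R, 0 < d &
      ball (k / m) d `<=` [set x | c <= `|sin (pi * x)|].
    by apply/nbhs_ballP.
  exists (Num.min d 1); split; first by rewrite lt_min d0 ltr01.
    by rewrite ge_min lexx orbT.
  by move=> x; rewrite lt_min => /andP[xd _]; apply: hd; rewrite /ball/= distrC.
set B := 2 / c * C; have B0 : 0 <= B by rewrite mulr_ge0// divr_ge0// ltW.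
set A := C / (`|m| * d); have A0 : 0 <= A by rewrite divr_ge0// mulr_ge0// ltW.
exists (B + A); first by rewrite addr_ge0.
move=> r eta x r0 e0 e1 Jx; have Jx' : 0 < m * x - k := Jx.
have T2 : 0 <= (B + A) / (r * eta) * weight x.
  by rewrite mulr_ge0 ?(ltW (wp x))// divr_ge0 ?addr_ge0// mulr_ge0// ltW.
have T1 : 0 <= (B + A) * \1_(window eta) x by rewrite mulr_ge0// addr_ge0.
have pC : cnorm1 (phi x) <= C.
  by apply: le_trans (hC x) _; rewrite ler_piMr// weight_le1.
have p0 := cnorm1_ge0 (phi x).
have [/andP[xe xd]|far] := boolP ((`|x - k / m| < eta) && (`|x - k / m| < d)).
  apply: (@le_trans _ _ B); last first.
    by move: T2; rewrite in_window//; lra.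
  rewrite /B; apply: ler_pM => //.
  have := sin_tail_le x r0 Jx'; have := hd x xd.
  rewrite ler_pdivlMr// => h1; apply: le_trans.
  by rewrite mulrC ler_wpM2r.
(* Out of one of the two balls, the distance to k / m is at least eta * d, as
   both radii are at most 1. *)
have fd : eta * d <= `|x - k / m|.
  move: far; rewrite negb_and -!leNgt => /orP[]; apply: le_trans.
    by rewrite ler_piMr// ltW.
  by rewrite ler_piMl// ltW.
apply: (@le_trans _ _ (A / (r * eta) * weight x)); last first.
  move: T1; have : 0 <= B / (r * eta) * weight x.
    by rewrite mulr_ge0 ?(ltW (wp x))// divr_ge0// mulr_ge0// ltW.
  lra.
have h1 := tl r x r0 Jx; have h2 := hC x; have w0 := wp x.
have t0 := normr_ge0 (tail r x (m * x - k)).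
rewrite /A; move: (`|tail _ _ _|) (`|x - k / m|) (cnorm1 _) p0 (weight x) (`|m|)
  mp t0 w0 h1 h2 fd => t D p p0 w M M0 t0 w0 h1 h2 fd.
have -> : C / (M * d) / (r * eta) * w = C * w / (r * eta * (M * d)).
  by field; rewrite !gt_eqF.
rewrite ler_pdivlMr ?mulr_gt0// mulrA.
have -> : t * p * (r * eta) * (M * d) = p * (t * (r * (M * (eta * d)))) by ring.
apply: le_trans h2; rewrite -[leRHS]mulr1 ler_wpM2l//; apply: le_trans h1.
by rewrite ler_wpM2l// ler_wpM2l ?(ltW r0)// ler_wpM2l ?(ltW M0).
Qed.

(** The contribution to w_r phi of the modes of index greater than cutoff r;
    the wave of frequency 0 and dispersion r ^ 2 is their common phase. *)
Definition remainder r (x : R) : R[i] :=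
  (phi x * wave m k 0 (r ^+ 2)%:C x) * (tail r x (m * x - k))%:C.

Lemma integrable_window (C : R) eta :
  mu.-integrable J (EFin \o (fun x => C * \1_(window eta) x)).
Proof.
have mJ := measurable_halfline k m0.
rewrite /comp; under eq_fun do rewrite EFinM; apply: integrableZl => //.
by apply: (@integrableS _ _ _ mu setT) => //; exact: integrable_indic_itv.
Qed.

Lemma Rintegral_window eta : 0 <= eta ->
  \int[mu]_(x in J) (\1_(window eta) x) <= 2 * eta.
Proof.
move=> e0; have mJ := measurable_halfline k m0.
have mwin : measurable (window eta : set (measurableTypeR R)).
  exact: measurable_itv.
rewrite /Rintegral integral_indic//.
have mw : (mu (window eta) = (2 * eta)%:E)%E.
  rewrite /window lebesgue_measure_itv/= lte_fin; case: ifPn => h.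
    by rewrite -EFinB; congr EFin; ring.
  by congr EFin; move: h; rewrite -leNgt; lra.
rewrite -lee_fin fineK.
  rewrite -mw; apply: le_measure; rewrite ?inE//; exact: measurableI.
rewrite ge0_fin_numE//; apply: (@le_lt_trans _ _ (mu (window eta))).
  apply: le_measure; rewrite ?inE//; exact: measurableI.
by rewrite mw ltry.
Qed.

Lemma cnorm1_remainder r x : J x ->
  cnorm1 (remainder r x) <= 2 * (`|tail r x (m * x - k)| * cnorm1 (phi x)).
Proof.
move=> Jx; apply: le_trans (cnorm1M _ _) _; rewrite cnorm1_real.
apply: le_trans (ler_wpM2r (normr_ge0 _) (cnorm1M _ _)) _.
have := @cnorm1_wave R m k 0 (r ^+ 2)%:C x (lexx 0) (ltW Jx).
have := cnorm1_ge0 (phi x); have := normr_ge0 (tail r x (m * x - k)).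
move: (cnorm1 (wave _ _ _ _ _)) (cnorm1 _) (`|_|) => a b c c0 b0 a2.
have := ler_wpM2l (mulr_ge0 b0 c0) a2; lra.
Qed.

Lemma measurable_remainder r : 0 < r ->
  measurable_fun (J : set (measurableTypeR R)) (Re \o remainder r) /\
  measurable_fun (J : set (measurableTypeR R)) (Im \o remainder r).
Proof.
move=> r0; have [sr si] := sphi.
have [c1 c2] := @continuousM_wave _ m k phi 0 (r ^+ 2)%:C
  (rschwartz_continuous sr) (rschwartz_continuous si).
have mt := @measurable_tail R m k r m0 r0.
have -> : Re \o remainder r = (fun x =>
    (Re \o (fun x => phi x * wave m k 0 (r ^+ 2)%:C x)) x * tail r x (m * x - k)).
  by apply/funext => x; rewrite /remainder /comp cReM /= mulr0 subr0.
have -> : Im \o remainder r = (fun x =>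
    (Im \o (fun x => phi x * wave m k 0 (r ^+ 2)%:C x)) x * tail r x (m * x - k)).
  by apply/funext => x; rewrite /remainder /comp cImM /= mulr0 add0r.
by split; apply: measurable_funM => //; apply: measurable_funTS;
  exact: continuous_measurable_fun.
Qed.

(** The window contributes its length, the rest of the half-line
    O(1 / (r * eta)). *)
Lemma remainder_bound : exists2 C, 0 <= C & forall r eta, 0 < r ->
  0 < eta -> eta <= 1 -> cintegrable J (remainder r) /\
  cnorm1 (cintegral J (remainder r)) <= C * eta + C / (r * eta).
Proof.
have mJ := measurable_halfline k m0.
have [C C0 hC] := tail_phi_bound.
set W := \int[mu]_(x in J) weight x.
have W0 : 0 <= W by rewrite Rintegral_ge0// => x _; exact/ltW/weight_gt0.
exists (8 * C + 4 * C * W); first by rewrite addr_ge0// !mulr_ge0.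
move=> r eta r0 e0 e1; have re0 : 0 < r * eta by rewrite mulr_gt0.
pose g x : R := 2 * C * \1_(window eta) x + 2 * C / (r * eta) * weight x.
have iw := integrable_window (2 * C) eta.
have iW := @integrable_weightZ _ J (2 * C / (r * eta)) mJ.
have ig : mu.-integrable J (EFin \o g).
  by rewrite /comp /g; under eq_fun do rewrite EFinD; exact: integrableD.
have le_g x : J x -> cnorm1 (remainder r x) <= g x.
  move=> Jx; apply: le_trans (cnorm1_remainder r Jx) _.
  have := hC r eta x r0 e0 e1 Jx; rewrite /g; lra.
have [m1 m2] := measurable_remainder r0.
have ir : cintegrable J (remainder r) by exact: (cintegrable_le mJ m1 m2 ig).
split=> //; apply: le_trans (cnorm1_cintegral_le mJ ir ig le_g) _.
have i1 : mu.-integrable J (EFin \o (fun x => (\1_(window eta) x : R))).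
  have := integrable_window 1 eta; apply: eq_integrable => // x _ /=.
  by rewrite mul1r.
rewrite /g RintegralD// !RintegralZl//; last exact: integrable_weight.
have := Rintegral_window (ltW e0).
rewrite -/W; move: (\int[mu]_(x in J) _) => I hI.
have C4 : 0 <= 4 * C by rewrite mulr_ge0.
have := ler_wpM2l C4 hI.
have : 0 <= 8 * C / (r * eta) by rewrite divr_ge0 ?(ltW re0)// mulr_ge0.
have : 0 <= 4 * C * W * eta by rewrite !mulr_ge0// ltW.
lra.
Qed.

End Remainder.

(** * Convergence on a half-line *)

Section HalfLine.
Variables (R : realType) (m k : R) (phi : R -> R[i]).
Hypotheses (m0 : m != 0) (sphi : schwartz phi).
Hypothesis hk : k / m \is a Num.int -> phi (k / m) = 0.
Local Notation Re := (@complex.Re R).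
Local Notation Im := (@complex.Im R).
Local Notation mu := (@lebesgue_measure R).
Local Notation J := (halfline m k).

Lemma cnorm1_zpair_le (u : int -> R[i]) (j : nat) (b : R) :
  cnorm1 (u j%:Z) <= b -> cnorm1 (u (- j%:Z)) <= b -> cnorm1 (zpair u j) <= 2 * b.
Proof.
move=> h1 h2; rewrite /zpair; case: eqP => [j0|_].
  by rewrite j0 in h1; have := cnorm1_ge0 (u 0); lra.
by apply: le_trans (cnorm1D _ _) _; lra.
Qed.

Lemma zpairB (u v : int -> R[i]) (j : nat) :
  zpair u j - zpair v j = zpair (fun n => u n - v n) j.
Proof. by rewrite /zpair; case: eqP => // _; ring. Qed.

(** The terms of the pairing of v with phi are coefficients of waves with
    dispersion n ^ 2 / 2, the limit of the dispersion of w_r. *)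
Lemma v_coefE (n : int) :
  v_coef J (fun x => m * x - k) phi n = wave_coef m k phi n (n%:~R ^+ 2 / 2)%:C.
Proof.
apply: eq_cintegral => x _; congr (_ * _); rewrite /wave; congr cexp.
by apply: complexP => /=; field.
Qed.

Lemma v_coef_bound : exists D, forall n : int,
  cnorm1 (v_coef J (fun x => m * x - k) phi n) <= D / (1 + n%:~R ^+ 2).
Proof.
have [D _ hD] := wave_coef_bound k m0 sphi.
exists D => n; rewrite v_coefE; apply: hD => //.
rewrite cnorm1_real; apply: le_trans (ler_norm _).
by have := sqr_ge0 (n%:~R : R); lra.
Qed.

Lemma cintegrable_zpair_wave r (j : nat) : 0 < r ->
  cintegrable J (fun x => zpair (fun n => phi x * wave m k n (dispersion r n) x) j).
Proof.
move=> r0; have mJ := measurable_halfline k m0.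
have i n : cintegrable J (fun x => phi x * wave m k n (dispersion r n) x).
  by apply: cintegrable_wave_coef => //; exact: dispersion_Im_le0.
by rewrite /zpair; case: eqP => // _; exact: cintegrableD.
Qed.

Lemma cintegral_zpair_wave r (j : nat) : 0 < r ->
  cintegral J (fun x => zpair (fun n => phi x * wave m k n (dispersion r n) x) j) =
  zpair (fun n => wave_coef m k phi n (dispersion r n)) j.
Proof.
move=> r0; have mJ := measurable_halfline k m0.
have i n : cintegrable J (fun x => phi x * wave m k n (dispersion r n) x).
  by apply: cintegrable_wave_coef => //; exact: dispersion_Im_le0.
by rewrite /zpair; case: eqP => // _; exact: cintegralD.
Qed.

Lemma w_phi_split r x : 0 < r -> J x ->
  w r x (m * x - k) * phi x =
  \sum_(0 <= n < (cutoff r).+1)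
    zpair (fun n => phi x * wave m k n (dispersion r n) x) n + remainder m k phi r x.
Proof.
move=> r0 Jx; rewrite (w_split r0 Jx) mulrDl mulr_suml; congr (_ + _).
  by apply: eq_bigr => n _; rewrite mulrC zpairMl.
rewrite /remainder [LHS]mulrAC [X in X * _ = _]mulrC; congr (_ * _ * _).
rewrite /wave; congr cexp.
by apply: complexP => /=; ring.
Qed.

Lemma halfline_pairing r : 0 < r ->
  fun_pairing_defined J (fun x => w r x (m * x - k)) phi /\
  fun_pairing J (fun x => w r x (m * x - k)) phi =
    \sum_(0 <= n < (cutoff r).+1)
      zpair (fun n => wave_coef m k phi n (dispersion r n)) n +
    cintegral J (remainder m k phi r).
Proof.
move=> r0; have mJ := measurable_halfline k m0.
have [C C0 hC] := remainder_bound m0 sphi hk.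
have [ir _] := hC r 1 r0 ltr01 (lexx _).
have is_ : cintegrable J (fun x => \sum_(0 <= n < (cutoff r).+1)
    zpair (fun n => phi x * wave m k n (dispersion r n) x) n).
  by apply: cintegrable_sum => // n _; exact: cintegrable_zpair_wave.
split.
  apply: (eq_cintegrable mJ _ (cintegrableD mJ is_ ir)) => x Jx.
  by rewrite w_phi_split.
rewrite /fun_pairing.
rewrite (eq_cintegral (fun x Jx => w_phi_split r0 Jx)) cintegralD//; congr (_ + _).
rewrite cintegral_sum//; last by move=> n _; exact: cintegrable_zpair_wave.
by apply: eq_bigr => n _; exact: cintegral_zpair_wave.
Qed.

Lemma halfline_remainder_cvg0 (e : R) : 0 < e ->
  \forall r \near +oo, cnorm1 (cintegral J (remainder m k phi r)) <= e.
Proof.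
move=> e0; have [C C0 hC] := remainder_bound m0 sphi hk.
have C1 : 0 < 2 * (C + 1) by lra.
(* The width eta of the window is chosen first, to make C * eta small; then r
   is taken large. *)
pose eta := Num.min 1 (e / (2 * (C + 1))).
have eta0 : 0 < eta by rewrite lt_min ltr01 divr_gt0.
have eta1 : eta <= 1 by rewrite ge_min lexx.
have Ceta : C * eta <= e / 2.
  have : eta <= e / (2 * (C + 1)) by rewrite ge_min lexx orbT.
  rewrite ler_pdivlMr//; nra.
near=> r.
have r0 : 0 < r by near: r; apply: nbhs_pinfty_gt; rewrite num_real.
have r1 : 2 * C / (e * eta) <= r by near: r; apply: nbhs_pinfty_ge; rewrite num_real.
have [_ h] := hC r eta r0 eta0 eta1.
apply: le_trans h _.
suff : C / (r * eta) <= e / 2 by lra.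
rewrite ler_pdivrMr ?mulr_gt0//.
by rewrite ler_pdivrMr ?mulr_gt0// in r1; lra.
Unshelve. all: by end_near. Qed.

(** For a fixed n, the mode is propagating as soon as r >= |n|. *)
Lemma mode_coef_cvg (n : int) (e : R) : 0 < e -> \forall r \near +oo,
  cnorm1 (wave_coef m k phi n (dispersion r n) -
          wave_coef m k phi n (n%:~R ^+ 2 / 2)%:C) <= e.
Proof.
move=> e0; have [K K0 hK] := wave_coef_lipschitz k m0 sphi.
near=> r.
have r1 : 1 <= r by near: r; apply: nbhs_pinfty_ge; rewrite num_real.
have rn : `|n%:~R| <= r by near: r; apply: nbhs_pinfty_ge; rewrite num_real.
have re : K * n%:~R ^+ 4 / e <= r by near: r; apply: nbhs_pinfty_ge; rewrite num_real.
have r0 : 0 < r by apply: lt_le_trans r1.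
rewrite dispersion_propagating//.
apply: le_trans (hK _ _ _) _.
have [_ h] := real_dispersion_bound r0 rn.
apply: le_trans (ler_wpM2l K0 h) _.
rewrite mulrA ler_pdivrMr ?exprn_gt0//.
rewrite ler_pdivrMr// in re; apply: le_trans re _.
rewrite mulrC ler_wpM2l ?(ltW e0)// expr2; nra.
Unshelve. all: by end_near. Qed.

Lemma v_partial_sums_cvg (zeta : R -> R) (A : set R) (D e : R) : 0 < e ->
  (forall n : int, cnorm1 (v_coef A zeta phi n) <= D / (1 + n%:~R ^+ 2)) ->
  \forall M \near \oo,
    cnorm1 (\sum_(0 <= n < M.+1) zpair (v_coef A zeta phi) n - v_pairing A zeta phi) <= e.
Proof.
move=> e0 hD.
have cr := cvg_zsumR (fun n => le_trans (cnorm1_Re _) (hD n)).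
have ci := cvg_zsumR (fun n => le_trans (cnorm1_Im _) (hD n)).
have e2 : 0 < e / 2 by rewrite divr_gt0.
move/cvgrPdist_le : cr => /(_ _ e2) cr; move/cvgrPdist_le : ci => /(_ _ e2) ci.
near=> M.
rewrite /cnorm1 cReD cImD cReN cImN cRe_sum cIm_sum /v_pairing /zsum /=.
under eq_bigr do rewrite Re_zpair.
under [X in _ + `|X - _| <= _]eq_bigr do rewrite Im_zpair.
rewrite [leRHS](splitr e) lerD//.
  by rewrite distrC; near: M.
by rewrite distrC; near: M.
Unshelve. all: by end_near. Qed.

Lemma halfline_cvg : cvg_to_v J (fun r x => w r x (m * x - k)) (fun x => m * x - k) phi.
Proof.
have [D0 hD0] := v_coef_bound.
split.
- by move=> r r0; have [] := halfline_pairing r0.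
- split; apply: (@summable_int _ _ D0) => n.
  + exact: le_trans (cnorm1_Re _) (hD0 n).
  + exact: le_trans (cnorm1_Im _) (hD0 n).
apply: ccvg_pinftyP => e e0; have e2 : 0 < e / 2 by rewrite divr_gt0.
have [D D_ge0 hD] := wave_coef_bound k m0 sphi.
have sum_cvg := @tannery R
  (fun r j => zpair (fun n => wave_coef m k phi n (dispersion r n)) j)
  (zpair (v_coef J (fun x => m * x - k) phi))
  (v_pairing J (fun x => m * x - k) phi) (@cutoff R) (2 * D + 2 * `|D0|) _ _ _ _ _ _ e2.
have rem_cvg := halfline_remainder_cvg0 e2.
have near_sum : \forall r \near +oo, cnorm1 (\sum_(0 <= j < (cutoff r).+1)
    zpair (fun n => wave_coef m k phi n (dispersion r n)) j -
    v_pairing J (fun x => m * x - k) phi) <= e / 2.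
  apply: sum_cvg.
  - move=> j d d0; have d2 : 0 < d / 2 by rewrite divr_gt0.
    have n1 := mode_coef_cvg j%:Z d2; have n2 := mode_coef_cvg (- j%:Z) d2.
    near=> r; rewrite zpairB; apply: le_trans (cnorm1_zpair_le (b := d / 2) _ _) _.
    + by rewrite v_coefE; near: r.
    + by rewrite v_coefE; near: r.
    + by rewrite mulrC divfK.
  - near=> r => j jr.
    have r1 : 1 <= r by near: r; apply: nbhs_pinfty_ge; rewrite num_real.
    have r0 : 0 < r by apply: lt_le_trans r1.
    have jr1 : j%:R <= r + 1.
      by apply: le_trans (cutoff_le r0); rewrite ler_nat.
    apply: (@le_trans _ _ (2 * (D / (1 + j%:R ^+ 2)))).
      apply: cnorm1_zpair_le.
      + by rewrite pmulrn; apply: hD; [exact: dispersion_Im_le0|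
          apply: dispersion_ge => //; rewrite -pmulrn ger0_norm].
      + have -> : j%:R ^+ 2 = (- j%:Z)%:~R ^+ 2 :> R by rewrite rmorphN/= sqrrN -pmulrn.
        by apply: hD; [exact: dispersion_Im_le0|
          apply: dispersion_ge => //; rewrite rmorphN/= normrN -pmulrn ger0_norm].
    rewrite mulrA; apply: ler_wpM2r; first by rewrite invr_ge0 ltW// oneDsqr_gt0.
    by rewrite lerDl mulr_ge0.
  - move=> j; apply: (@le_trans _ _ (2 * (`|D0| / (1 + j%:R ^+ 2)))).
      have hD1 n : cnorm1 (v_coef J (fun x => m * x - k) phi n) <=
          `|D0| / (1 + n%:~R ^+ 2).
        apply: le_trans (hD0 n) _; apply: ler_wpM2r (ler_norm _).
        by rewrite invr_ge0 ltW// oneDsqr_gt0.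
      apply: cnorm1_zpair_le; first by rewrite pmulrn; exact: hD1.
      have -> : j%:R ^+ 2 = (- j%:Z)%:~R ^+ 2 :> R by rewrite rmorphN/= sqrrN -pmulrn.
      exact: hD1.
    rewrite mulrA; apply: ler_wpM2r; first by rewrite invr_ge0 ltW// oneDsqr_gt0.
    by rewrite lerDr mulr_ge0.
  - move=> M; near=> r.
    have r1 : 1 <= r by near: r; apply: nbhs_pinfty_ge; rewrite num_real.
    have rM : M%:R <= r by near: r; apply: nbhs_pinfty_ge; rewrite num_real.
    have r0 : 0 < r by apply: lt_le_trans r1.
    by rewrite -(ler_nat R) ltW// (le_lt_trans rM)// cutoff_gt.
  - by move=> d d0; exact: v_partial_sums_cvg hD0.
near=> r.
have r0 : 0 < r by near: r; apply: nbhs_pinfty_gt; rewrite num_real.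
have [_ ->] := halfline_pairing r0.
rewrite addrAC; apply: le_trans (cnorm1D _ _) _; rewrite [leRHS](splitr e) lerD//.
  by near: r.
by near: r.
Unshelve. all: by end_near. Qed.

End HalfLine.

(** * Convergence on the whole line *)

Section WholeLine.
Variable R : realType.
Implicit Types (m k : R) (phi : R -> R[i]).
Local Notation Re := (@complex.Re R).
Local Notation Im := (@complex.Im R).

Lemma zsumRD (u v : int -> R) (D E : R) :
  (forall n : int, `|u n| <= D / (1 + n%:~R ^+ 2)) ->
  (forall n : int, `|v n| <= E / (1 + n%:~R ^+ 2)) ->
  zsumR (fun n => u n + v n) = zsumR u + zsumR v.
Proof.
move=> hu hv; rewrite {1}/zsumR; apply: cvg_lim => //.
rewrite (_ : (fun _ => _) = (fun N => \sum_(0 <= n < N.+1) zpair u n +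
    \sum_(0 <= n < N.+1) zpair v n)).
  by apply: cvgD; [exact: cvg_zsumR hu|exact: cvg_zsumR hv].
apply/funext => N; rewrite -big_split /= (sum_zpair (fun n => u n + v n)).
apply: eq_bigr => n _.
by rewrite /zpair; case: eqP => // _; ring.
Qed.

Lemma zsumD (u v : int -> R[i]) (D E : R) :
  (forall n : int, cnorm1 (u n) <= D / (1 + n%:~R ^+ 2)) ->
  (forall n : int, cnorm1 (v n) <= E / (1 + n%:~R ^+ 2)) ->
  zsum (fun n => u n + v n) = zsum u + zsum v.
Proof.
move=> hu hv; apply: complexP; rewrite /zsum /=.
- under eq_fun do rewrite cReD.
  by apply: zsumRD => n; [exact: le_trans (cnorm1_Re _) (hu n)|
    exact: le_trans (cnorm1_Re _) (hv n)].
- under eq_fun do rewrite cImD.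
  by apply: zsumRD => n; [exact: le_trans (cnorm1_Im _) (hu n)|
    exact: le_trans (cnorm1_Im _) (hv n)].
Qed.

Lemma setT_halflines m k : m != 0 ->
  [set: R] = halfline m k `|` (halfline (- m) (- k) `|` [set k / m]).
Proof.
move=> m0; apply/seteqP; split => // x _; rewrite /halfline /=.
have [h|h|h] := ltgtP 0 (m * x - k); first by left.
  by right; left; lra.
right; right; apply: (mulfI m0); rewrite mulrC mulrCA mulfV// mulr1.
by rewrite mulrC; lra.
Qed.

Lemma disjoint_halflines m k : m != 0 ->
  [disjoint halfline m k & halfline (- m) (- k) `|` [set k / m]] /\
  [disjoint halfline (- m) (- k) & [set k / m]].
Proof.
move=> m0; split; apply/disj_setPS => x; rewrite /halfline /=.
  by move=> [h [h'|xk]]; [lra|rewrite xk mulrC divfK// in h; lra].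
by move=> [h xk]; rewrite xk mulNr mulrC divfK// in h; lra.
Qed.

Lemma cintegral_line m k (F : R -> R[i]) : m != 0 ->
  cintegrable (halfline m k) F -> cintegrable (halfline (- m) (- k)) F ->
  cintegrable [set: R] F /\
  cintegral [set: R] F =
    cintegral (halfline m k) F + cintegral (halfline (- m) (- k)) F.
Proof.
move=> m0 ip iN; have [d1 d2] := disjoint_halflines k m0.
have mp := measurable_halfline k m0.
have mN : measurable (halfline (- m) (- k) : set (measurableTypeR R)).
  by apply: measurable_halfline; rewrite oppr_eq0.
have m1 : measurable ([set k / m] : set (measurableTypeR R)) by [].
have i1 := cintegrable_set1 (k / m) F.
have iN1 := cintegrable_setU mN m1 d2 iN i1.
have mN1 := measurableU _ _ mN m1.
rewrite (setT_halflines k m0); split; first exact: cintegrable_setU.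
by rewrite !cintegral_setU// cintegral_set1 addr0.
Qed.

Lemma ccvg_pinftyD (F G : R -> R[i]) (a b : R[i]) :
  ccvg_pinfty F a -> ccvg_pinfty G b -> ccvg_pinfty (fun r => F r + G r) (a + b).
Proof.
move=> [Fr Fi] [Gr Gi]; split.
- by under eq_fun do rewrite cReD; rewrite cReD; exact: cvgD.
- by under eq_fun do rewrite cImD; rewrite cImD; exact: cvgD.
Qed.

Lemma ccvg_pinfty_ext (F G : R -> R[i]) (a : R[i]) :
  (forall r, 0 < r -> F r = G r) -> ccvg_pinfty F a -> ccvg_pinfty G a.
Proof.
move=> FG; have h : \forall r \near +oo, F r = G r.
  by near=> r; apply: FG; near: r; apply: nbhs_pinfty_gt; rewrite num_real.
move=> [Fr Fi]; split.
- by apply: cvg_trans Fr; apply: near_eq_cvg; apply: filterS h => r ->.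
- by apply: cvg_trans Fi; apply: near_eq_cvg; apply: filterS h => r ->.
Unshelve. all: by end_near. Qed.

(** The half-line where the line lies below the axis is the upper one for the
    opposite line, on which w takes the same values. *)
Lemma w_opp r x m k : w r x (- m * x - - k) = w r x (m * x - k).
Proof.
have -> : - m * x - - k = - (m * x - k) by ring.
by rewrite /w normrN.
Qed.

Lemma whole_line_cvg m k phi : m != 0 -> schwartz phi ->
  (k / m \is a Num.int -> phi (k / m) = 0) ->
  cvg_to_v [set: R] (fun r x => w r x (m * x - k)) (fun x => `|m * x - k|) phi.
Proof.
move=> m0 sphi hk; have mN0 : - m != 0 by rewrite oppr_eq0.
have hkN : - k / - m \is a Num.int -> phi (- k / - m) = 0.
  by rewrite invrN mulrNN.
have mp := measurable_halfline k m0.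
have mN := measurable_halfline (- k) mN0.
have [dp sp cp] := halfline_cvg m0 sphi hk.
have [dN sN cN] := halfline_cvg mN0 sphi hkN.
have [D hD] := v_coef_bound k m0 sphi.
have [E hE] := v_coef_bound (- k) mN0 sphi.
have dN' r : 0 < r -> cintegrable (halfline (- m) (- k))
    (fun x => w r x (m * x - k) * phi x).
  by move=> r0; apply: (eq_cintegrable mN _ (dN r r0)) => x _; rewrite w_opp.
have vE n : v_coef [set: R] (fun x => `|m * x - k|) phi n =
    v_coef (halfline m k) (fun x => m * x - k) phi n +
    v_coef (halfline (- m) (- k)) (fun x => - m * x - - k) phi n.
  rewrite /v_coef.
  set F := fun x : R => _.
  have Fp : {in halfline m k, forall x, F x = phi x *
      cexp ('i%C * (2 * pi * n%:~R * x)%:C - 'i%C * (pi * n%:~R ^+ 2 * (m * x - k))%:C)}.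
    by move=> x /set_mem Jx; rewrite /F gtr0_norm.
  have FN : {in halfline (- m) (- k), forall x, F x = phi x *
      cexp ('i%C * (2 * pi * n%:~R * x)%:C - 'i%C * (pi * n%:~R ^+ 2 * (- m * x - - k))%:C)}.
    move=> x /set_mem Jx; rewrite /F; have Jx' : 0 < - m * x - - k := Jx.
    by rewrite ltr0_norm; [congr (_ * cexp (_ - 'i%C * (_ * _)%:C)); ring|lra].
  have l0 : Im (n%:~R ^+ 2 / 2)%:C <= 0 by [].
  have waveE M K x : wave M K n (n%:~R ^+ 2 / 2)%:C x =
      cexp ('i%C * (2 * pi * n%:~R * x)%:C - 'i%C * (pi * n%:~R ^+ 2 * (M * x - K))%:C).
    by rewrite /wave; congr cexp; apply: complexP => /=; field.
  have iP : cintegrable (halfline m k) F.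
    apply: (eq_cintegrable mp _ (cintegrable_wave_coef k m0 sphi n l0)) => x Jx.
    by rewrite waveE Fp// inE.
  have iN : cintegrable (halfline (- m) (- k)) F.
    apply: (eq_cintegrable mN _ (cintegrable_wave_coef (- k) mN0 sphi n l0)) => x Jx.
    by rewrite waveE FN// inE.
  have [_ ->] := cintegral_line m0 iP iN.
  by congr (_ + _); apply: eq_cintegral => x Jx; [rewrite Fp ?inE|rewrite FN ?inE].
have vb n : cnorm1 (v_coef [set: R] (fun x => `|m * x - k|) phi n) <=
    (D + E) / (1 + n%:~R ^+ 2).
  by rewrite vE mulrDl; apply: le_trans (cnorm1D _ _) _; rewrite lerD.
split.
- by move=> r r0; have [] := cintegral_line m0 (dp r r0) (dN' r r0).
- split; apply: (@summable_int _ _ (D + E)) => n.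
  + exact: le_trans (cnorm1_Re _) (vb n).
  + exact: le_trans (cnorm1_Im _) (vb n).
have -> : v_pairing [set: R] (fun x => `|m * x - k|) phi =
    v_pairing (halfline m k) (fun x => m * x - k) phi +
    v_pairing (halfline (- m) (- k)) (fun x => - m * x - - k) phi.
  rewrite /v_pairing -(zsumD hD hE); congr zsum; exact/funext.
apply: ccvg_pinfty_ext (ccvg_pinftyD cp cN) => r r0.
have eqN : cintegral (halfline (- m) (- k)) (fun x => w r x (m * x - k) * phi x) =
    fun_pairing (halfline (- m) (- k)) (fun x => w r x (- m * x - - k)) phi.
  by apply: eq_cintegral => x _; rewrite w_opp.
have [_ eqT] := cintegral_line m0 (dp r r0) (dN' r r0).
by rewrite -eqN; exact: esym eqT.
Qed.

End WholeLine.

(* For k / m an integer, w r xi (m * xi - k) has a singularity of order exactly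
   |xi - k / m|^-1 at k / m for every r > 0, so that its integral against phi
   exists only when phi (k / m) = 0; this is the role of hk, which is void when
   k / m is not an integer. *)
Theorem theorem3 (R : realType) (m k : R) (phi : R -> R[i])
  (hphi : schwartz phi)
  (hk : k / m \is a Num.int -> phi (k / m) = 0) :
  [/\ 0 < m ->
        cvg_to_v `]k / m, +oo[%classic (fun r xi => w r xi (m * xi - k))
          (fun xi => m * xi - k) phi,
      m < 0 ->
        cvg_to_v `]-oo, k / m[%classic (fun r xi => w r xi (m * xi - k))
          (fun xi => m * xi - k) phi
    & m != 0 ->
        cvg_to_v [set: R] (fun r xi => w r xi (m * xi - k))
          (fun xi => `|m * xi - k|) phi].
Proof.
split=> m0.
- by rewrite -halfline_pos//; apply: halfline_cvg => //; rewrite gt_eqF.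
- by rewrite -halfline_neg//; apply: halfline_cvg => //; rewrite lt_eqF.
- exact: whole_line_cvg.
Qed.
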